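(* Let $\varepsilon_k\downarrow0$ be any sequence. For $\varepsilon>0$ and $z=(x,y)\in\mathbb{R}^{2d}$ let $R^{\varepsilon,z}$ be the law on $E$ of $\sqrt{\varepsilon}W^\circ+\sigma^{xy}$ (Brownian bridge from $x$ to $y$ with noise level $\varepsilon$), and let $$J_z(h)=\frac{\|h\|_H^2}{2}-\frac{|x-y|^2}{2}+\iota_{\{(x,y)\}}(h(0),h(1)),\qquad h\in E.$$ Then the following hold. (i) For every open set $A\subset E$, $$\liminf_{k\to\infty}\varepsilon_k\log R^{\varepsilon_k,z_k}(A)\ge-\inf_{h\in A}J_z(h)$$ whenever $z_k\to z$ in $\mathbb{R}^{2d}$. (ii) For every closed set $A\subset E$, $$\limsup_{k\to\infty}\varepsilon_k\log R^{\varepsilon_k,z_k}(A)\le-\inf_{h\in A}J_z(h)$$ whenever $z_k\to z$ in $\mathbb{R}^{2d}$.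
   Context: $|\cdot|$ is the Euclidean norm. $E$ is the space of continuous maps $[0,1]\to\mathbb{R}^d$ with the sup norm. $H$ is the space of absolutely continuous $h:[0,1]\to\mathbb{R}^d$ with $\int_0^1|\dot h(t)|^2dt<\infty$, with $\|h\|_H=(\int_0^1|\dot h(t)|^2dt)^{1/2}$; set $\|h\|_H=\infty$ for $h\in E\setminus H$. $W^\circ=(W(t)-tW(1))_{t\in[0,1]}$ is a standard Brownian bridge, where $W$ is a standard $d$-dimensional Brownian motion on $[0,1]$ started at $0$. $\sigma^{xy}(t)=(1-t)x+ty$ for $t\in[0,1]$. For a set $A$, $\iota_A(u)=0$ if $u\in A$ and $\iota_A(u)=\infty$ if $u\notin A$. Conventions: $\log0=-\infty$, $\inf\emptyset=\infty$. *)

(* Defs.v *)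
From HB Require Import structures.
From mathcomp Require Import all_boot all_order all_algebra.
From mathcomp Require Import all_classical all_reals all_analysis.

Set Implicit Arguments.
Unset Strict Implicit.
Unset Printing Implicit Defensive.

Import Order.TTheory GRing.Theory Num.Theory.
Import numFieldNormedType.Exports.

Local Open Scope classical_set_scope.
Local Open Scope ring_scope.

Section Euclid.
Context {R : realType} {d : nat}.
Implicit Types x y : 'rV[R]_d.

(* The norm of the library on ['rV[R]_d] is the maximum norm. *)
Definition enorm x : R := Num.sqrt (\sum_i x 0 i ^+ 2).

Lemma sumsq_ge0 x : 0 <= \sum_i x 0 i ^+ 2.
Proof. by apply: sumr_ge0 => i _; exact: sqr_ge0. Qed.

Lemma enorm_ge0 x : 0 <= enorm x. Proof. exact: sqrtr_ge0. Qed.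

Lemma enorm_sq x : enorm x ^+ 2 = \sum_i x 0 i ^+ 2.
Proof. by rewrite sqr_sqrtr// sumsq_ge0. Qed.

Lemma enorm0 : enorm 0 = 0.
Proof.
by rewrite /enorm big1 ?sqrtr0// => i _; rewrite mxE expr0n.
Qed.

Lemma enorm_eq0 x : enorm x = 0 -> x = 0.
Proof.
move=> x0; have : \sum_i x 0 i ^+ 2 = 0 by rewrite -enorm_sq x0 expr0n.
move=> /eqP; rewrite psumr_eq0; last by move=> i _; exact: sqr_ge0.
move=> /allP h; apply/rowP => i; rewrite mxE; apply/eqP.
by have := h i (mem_index_enum i); rewrite sqrf_eq0.
Qed.

Lemma enormN x : enorm (- x) = enorm x.
Proof.
by congr Num.sqrt; apply: eq_bigr => i _; rewrite mxE sqrrN.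
Qed.

Lemma enorm_dot x y : \sum_i x 0 i * y 0 i <= enorm x * enorm y.
Proof.
have [/enorm_eq0 ->|x0] := eqVneq (enorm x) 0.
  by rewrite enorm0 mul0r big1// => i _; rewrite mxE mul0r.
have [/enorm_eq0 ->|y0] := eqVneq (enorm y) 0.
  by rewrite enorm0 mulr0 big1// => i _; rewrite mxE mulr0.
have xy0 : 0 < enorm x * enorm y.
  by rewrite mulr_gt0// lt_neqAle eq_sym ?x0 ?y0 enorm_ge0.
have : 0 <= \sum_i (enorm y * x 0 i - enorm x * y 0 i) ^+ 2.
  by apply: sumr_ge0 => i _; exact: sqr_ge0.
rewrite (eq_bigr (fun i => enorm y ^+ 2 * x 0 i ^+ 2 + enorm x ^+ 2 * y 0 i ^+ 2
   - (enorm x * enorm y) *+ 2 * (x 0 i * y 0 i))); last first.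
  move=> i _; rewrite sqrrB !exprMn addrAC; congr (_ + _ - _).
  by rewrite !mulrnAl; congr (_ *+ 2); rewrite mulrACA [enorm y * _]mulrC.
rewrite sumrB big_split/= -!mulr_sumr -!enorm_sq subr_ge0.
rewrite [enorm y ^+ 2 * _]mulrC -mulr2n -exprMn mulrnAl lerMn2r/=.
by rewrite expr2 ler_pM2l.
Qed.

Lemma enormD x y : enorm (x + y) <= enorm x + enorm y.
Proof.
rewrite -ler_sqr ?nnegrE ?addr_ge0 ?enorm_ge0// sqrrD !enorm_sq.
rewrite (eq_bigr (fun i => x 0 i ^+ 2 + x 0 i * y 0 i *+ 2 + y 0 i ^+ 2)).
  rewrite !big_split/= -!enorm_sq lerD2r lerD2l.
  by rewrite -mulr2n lerMn2r/= enorm_dot.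
by move=> i _; rewrite mxE sqrrD.
Qed.

Lemma enorm_le_norm x : enorm x <= Num.sqrt d%:R * `|x|.
Proof.
rewrite -ler_sqr ?nnegrE ?mulr_ge0 ?sqrtr_ge0// ?enorm_ge0//.
rewrite enorm_sq exprMn sqr_sqrtr ?ler0n//.
rewrite -[d in d%:R]card_ord -sum1_card natr_sum mulr_suml.
apply: ler_sum => i _; rewrite mul1r -real_normK ?num_real//.
rewrite ler_sqr ?nnegrE//.
by rewrite [leRHS]mx_normrE; exact: (@le_bigmax _ _ _ 0 _ (0, i)).
Qed.

End Euclid.

Definition unit_itv (R : realType) : set R := `[0, 1].
Arguments unit_itv R : clear implicits.

Lemma unit_itv0_subproof (R : realType) : (0 : R) \in unit_itv R.
Proof. by rewrite inE/= /unit_itv/= in_itv/= lexx ler01. Qed.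

Lemma unit_itv1_subproof (R : realType) : (1 : R) \in unit_itv R.
Proof. by rewrite inE/= /unit_itv/= in_itv/= lexx ler01. Qed.

Definition I0 {R : realType} : unit_itv R := exist _ 0 (unit_itv0_subproof R).
Definition I1 {R : realType} : unit_itv R := exist _ 1 (unit_itv1_subproof R).

(* The space E, with the distance induced by the supremum norm. *)
Definition pathE (R : realType) (d : nat) : Type :=
  continuousType (unit_itv R) 'rV[R]_d.

HB.instance Definition _ (R : realType) (d : nat) := Choice.on (pathE R d).

Definition path_fun (R : realType) (d : nat) (h : pathE R d) :
  unit_itv R -> 'rV[R]_d := Continuous.sort h.
Coercion path_fun : pathE >-> Funclass.

Definition sup_norm (R : realType) (d : nat) (f : unit_itv R -> 'rV[R]_d) : R :=
  sup [set enorm (f t) | t in [set: unit_itv R]].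

Section SupDist.
Context {R : realType} {d : nat}.
Implicit Types f g h : pathE R d.

Lemma path_continuous h : continuous h. Proof. exact: cts_fun. Qed.

Definition sup_dist f g : R := sup_norm (fun t => f t - g t).


Lemma path_bounded f : exists M : R, forall t, enorm (f t) <= M.
Proof.
have cf : {within unit_itv R, continuous (valL (f : unit_itv R -> 'rV[R]_d))}.
  exact/subspace_valL_continuousP/path_continuous.
have /compact_bounded[M [_ Mf]] := continuous_compact cf (@segment_compact R 0 1).
exists (Num.sqrt d%:R * (M + 1)) => t.
rewrite (le_trans (enorm_le_norm _))// ler_wpM2l ?sqrtr_ge0//.
apply: (Mf (M + 1)); first by rewrite ltrDl.
exists (val t); first by have := valP t; rewrite inE.
by rewrite /valL_/= oinv_set_val valK.
Qed.

Lemma sup_dist_has_sup f g :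
  has_sup [set enorm (f t - g t) | t in [set: unit_itv R]].
Proof.
split; first by exists (enorm (f I0 - g I0)), I0.
have [M Mf] := path_bounded f; have [N Ng] := path_bounded g.
exists (M + N) => _ [t _ <-].
by rewrite (le_trans (enormD _ _))// enormN lerD.
Qed.

Lemma sup_dist_ub f g t : enorm (f t - g t) <= sup_dist f g.
Proof. by apply: ub_le_sup; [have [] := sup_dist_has_sup f g|exists t]. Qed.

Lemma sup_distxx f : sup_dist f f = 0.
Proof.
rewrite /sup_dist /sup_norm (_ : [set _ | _ in _] = [set 0]) ?sup1//.
apply/seteqP; split => [_ [t _ <-]|_ ->]; first by rewrite subrr enorm0.
by exists I0; rewrite ?subrr ?enorm0.
Qed.

Lemma sup_dist_eq0 f g : sup_dist f g = 0 -> f = g.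
Proof.
move=> fg0; apply/continuousEP => t; apply/eqP; rewrite -subr_eq0; apply/eqP.
by apply/enorm_eq0/le_anti; rewrite enorm_ge0 andbT -fg0 sup_dist_ub.
Qed.

Lemma sup_distC f g : sup_dist f g = sup_dist g f.
Proof.
by congr sup; apply: eq_imagel => t _; rewrite -enormN opprB.
Qed.

Lemma sup_dist_triangle g f h : sup_dist f h <= sup_dist f g + sup_dist g h.
Proof.
apply: ge_sup; first by have [] := sup_dist_has_sup f h.
move=> _ [t _ <-]; rewrite -(subrK (g t) (f t)) -addrA.
by rewrite (le_trans (enormD _ _))// lerD// sup_dist_ub.
Qed.

End SupDist.

HB.instance Definition _ (R : realType) (d : nat) :=
  isMetric.Build R (pathE R d) sup_distxx sup_dist_eq0 sup_distC
    sup_dist_triangle.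

HB.instance Definition _ (R : realType) (d : nat) := isPointed.Build (pathE R d)
  (mkcts (@cst_continuous (unit_itv R) 'rV[R]_d 0) : continuousType _ _).

Notation borelE R d := (g_sigma_algebraType (@open (pathE R d))).

Section BrownianMotion.
Context {R : realType} {disp : measure_display} {Omega : measurableType disp}.
Variable P : probability Omega R.

(* Some [B i] may be [setT], so the product rule for every subfamily is
   included. *)
Definition mutually_independent (I : finType) (X : I -> Omega -> R) : Prop :=
  forall B : I -> set R, (forall i, measurable (B i)) ->
    P (\bigcap_(i in [set: I]) X i @^-1` B i) =
    (\prod_(i : I) P (X i @^-1` B i))%E.

(* The law N(0, s I_d) is the law of [d] independent N(0, s) coordinates, so the
   independence of the increments and the product form of their laws together
   amount to the mutual independence of all the coordinates of all the
   increments.  The second parameter of [normal_prob] is the standard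
   deviation. *)
Record standard_brownian_motion (d : nat) (W : Omega -> pathE R d) : Prop := {
  bm_start : forall w, W w I0 = 0 ;
  bm_measurable : forall (t : unit_itv R) (i : 'I_d),
    measurable_fun [set: Omega] (fun w => W w t 0 i) ;
  bm_independent : forall (n : nat) (t : 'I_n.+1 -> unit_itv R),
    (forall j k : 'I_n.+1, (j <= k)%N -> val (t j) <= val (t k)) ->
    mutually_independent (fun (ki : 'I_n * 'I_d) w =>
      (W w (t (lift ord0 ki.1)) - W w (t (widen_ord (leqnSn n) ki.1))) 0 ki.2) ;
  bm_gaussian : forall (s t : unit_itv R) (i : 'I_d), val s < val t ->
    forall B : set R, measurable B ->
    P ((fun w => (W w t - W w s) 0 i) @^-1` B) =
    normal_prob 0 (Num.sqrt (val t - val s)) B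
}.

End BrownianMotion.

Lemma affine_continuous (R : realType) (V : normedModType R)
  (X : topologicalType) (v : X -> R) (f : X -> V) (c : R) (a x y : V) :
  continuous v -> continuous f ->
  continuous (fun t => c *: (f t - v t *: a) + ((1 - v t) *: x + v t *: y)).
Proof.
move=> cval cf t.
have h : v t @[t --> t] --> v t by exact: cval.
have hf : f t @[t --> t] --> f t by exact: cf.
apply: (cvgD (f := fun t => c *: (f t - v t *: a))
             (g := fun t => (1 - v t) *: x + v t *: y)).
  apply: (cvgZ (s := fun=> c) (f := fun t => f t - v t *: a)).
    exact: cvg_cst.
  apply: (cvgB (g := fun t => v t *: a)); first exact: hf.
  by apply: (cvgZ (f := fun=> a)); [exact: h|exact: cvg_cst].
apply: (cvgD (f := fun t => (1 - v t) *: x) (g := fun t => v t *: y)).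
  apply: (cvgZ (s := fun t => 1 - v t) (f := fun=> x)); last exact: cvg_cst.
  by apply: (cvgB (V := R^o) (f := fun=> 1)); [exact: cvg_cst|exact: h].
by apply: (cvgZ (f := fun=> y)); [exact: h|exact: cvg_cst].
Qed.

Section BridgeLaw.
Context {R : realType} {d : nat}.
Implicit Types (eps : R) (z : 'rV[R]_d * 'rV[R]_d) (w : pathE R d).

Definition segment (x y : 'rV[R]_d) (t : unit_itv R) : 'rV[R]_d :=
  (1 - val t) *: x + val t *: y.

Definition bridge_fun w (t : unit_itv R) : 'rV[R]_d := w t - val t *: w I1.

Definition noisy_bridge_fun eps z w (t : unit_itv R) : 'rV[R]_d :=
  Num.sqrt eps *: bridge_fun w t + segment z.1 z.2 t.

Lemma noisy_bridge_continuous eps z w : continuous (noisy_bridge_fun eps z w).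
Proof.
by apply: affine_continuous; [exact: initial_continuous|exact: path_continuous].
Qed.

Definition noisy_bridge eps z w : pathE R d :=
  (mkcts (@noisy_bridge_continuous eps z w) : continuousType _ _).

Definition bridge_law {disp : measure_display} {Omega : measurableType disp}
    (P : probability Omega R) (W : Omega -> pathE R d) eps z :
    set (borelE R d) -> \bar R :=
  pushforward P (fun o : Omega => noisy_bridge eps z (W o) : borelE R d).

End BridgeLaw.

Section RateFunction.
Context {R : realType} {d : nat}.
Implicit Types h : pathE R d.

Definition abs_continuous h : Prop :=
  forall e : R, 0 < e -> exists2 delta : R, 0 < delta &
    forall (n : nat) (a b : 'I_n -> unit_itv R),
      (forall j, val (a j) <= val (b j)) ->
      trivIset [set: 'I_n] (fun j => `]val (a j), val (b j)[%classic) ->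
      \sum_(j < n) (val (b j) - val (a j)) < delta ->
      \sum_(j < n) enorm (h (b j) - h (a j)) < e.

(* [valL] extends [h] outside of [0, 1] by a constant; this only affects the
   derivative outside of the open interval ]0, 1[. *)
Definition velocity h : R -> 'rV[R]_d :=
  derive1 (valL (h : unit_itv R -> 'rV[R]_d)).

Definition energy h : \bar R :=
  (\int[lebesgue_measure]_(t in unit_itv R) (enorm (velocity h t) ^+ 2)%:E)%E.

Definition in_H h : Prop := abs_continuous h /\ (energy h < +oo)%E.

Definition H_norm h : \bar R := if `[< in_H h >] then sqrte (energy h) else +oo%E.

Definition iota_set (T : Type) (A : set T) (u : T) : \bar R :=
  if u \in A then 0%E else +oo%E.

Definition rate (z : 'rV[R]_d * 'rV[R]_d) h : \bar R :=
  (H_norm h ^+ 2 * 2^-1%:E - (enorm (z.1 - z.2) ^+ 2 / 2)%:E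
   + iota_set [set z] (h I0, h I1))%E.

End RateFunction.

(* Main.v *)
(* The bridge from x to y with noise level e is the image of sqrt e W under the
   affine 2-Lipschitz map that sends a path u starting at 0 to
   u(t) - t u(1) + (1 - t) x + t y.  The energy of the image exceeds the energy of
   u by at most |x - y|^2, by exactly that if u(1) = 0, and the map depends
   continuously on (x, y), so both bounds are those of Schilder's theorem for
   sqrt e W, transported by the map.

   The energy of a path is the supremum over m of its dyadic energies
   2^m sum_k |h((k+1)/2^m) - h(k/2^m)|^2.  A path with bounded dyadic energies is
   absolutely continuous; absolute continuity gives an integrable density, by the
   Radon-Nikodym theorem applied to Stieltjes measures built from the variation
   of the path, and the two inequalities between the energies follow from
   convexity of the square on each cell and from Fatou's lemma.

   For the lower bound, the independent Gaussian increments of level m lie in a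
   small box around those of a path of finite energy with probability at least
   about exp(-energy / (2 e)), and outside of an event of much smaller
   probability sqrt e W lies in a fixed Holder-type set, so that the increments
   control the whole path.  For the upper bound that set is compact, and it is
   covered by balls on which the increments of a suitable level m are confined to
   a box of probability at most C exp(-alpha / e). *)
Require Import Defs.
From HB Require Import structures.
From mathcomp Require Import all_boot all_order all_algebra.
From mathcomp Require Import all_classical all_reals all_analysis.
From mathcomp Require Import measurable_realfun.
From mathcomp Require Import ring lra.

Set Implicit Arguments.
Unset Strict Implicit.
Unset Printing Implicit Defensive.

Import Order.TTheory GRing.Theory Num.Theory.
Import numFieldNormedType.Exports.

Local Open Scope classical_set_scope.
Local Open Scope ring_scope.

(** * Dyadic points *)

Section Dyadic.
Context {R : realType}.
Implicit Types (t s : R) (m k : nat).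

(** Dyadic energies are where analysis and probability meet: [denergy m] involves finitely many
    increments, which are independent Gaussian variables for a Brownian path, and boundedness in [m]
    characterizes [H] without any derivative. The probability of a box of increments is then a
    product of one-dimensional Gaussian integrals. A box says nothing about a path between two
    points of its level, and continuity alone gives no rate there. This is the obstacle that
    [holder_set a] removes: its bounds [a (3/4)^l] decay more slowly than the standard deviations of
    the increments, so that a union bound over all levels gives the exceptional event a probability
    of order [exp (- 3 a^2 / (8 e))], and [a] is taken so large that this is dominated by the
    exponent under study. A second obstacle is measurability. The velocity is only identified almost
    everywhere, hence integrals are squeezed between those of measurable functions; path events are
    not measurable by definition, hence open sets are written as countable unions of sets given by
    coordinates. *)

Definition dyad m k : R := k%:R / 2 ^+ m.

Definition dfloor m t : nat := Num.truncn (t * 2 ^+ m).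

Lemma pow2_gt0 m : 0 < 2 ^+ m :> R.
Proof. by rewrite exprn_gt0. Qed.

Lemma natr_pow2 m : (2 ^ m)%:R = 2 ^+ m :> R.
Proof. by rewrite natrX. Qed.

Lemma dyad_ge0 m k : 0 <= dyad m k.
Proof. by rewrite divr_ge0// exprn_ge0. Qed.

Lemma dyad0 m : dyad m 0 = 0.
Proof. by rewrite /dyad mul0r. Qed.

Lemma dyad_full m : dyad m (2 ^ m) = 1.
Proof. by rewrite /dyad natr_pow2 divff// gt_eqF// pow2_gt0. Qed.

Lemma ler_dyad m k l : (dyad m k <= dyad m l) = (k <= l)%N.
Proof. by rewrite ler_pM2r ?invr_gt0 ?pow2_gt0// ler_nat. Qed.

Lemma ltr_dyad m k l : (dyad m k < dyad m l) = (k < l)%N.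
Proof. by rewrite ltr_pM2r ?invr_gt0 ?pow2_gt0// ltr_nat. Qed.

Lemma dyad_le1 m k : (k <= 2 ^ m)%N -> dyad m k <= 1.
Proof. by move=> k2; rewrite -(dyad_full m) ler_dyad. Qed.

Lemma dyadS m k : dyad m k.+1 = dyad m k + 2 ^- m.
Proof. by rewrite /dyad -natr1 mulrDl mul1r. Qed.

Lemma dyad_refine m p k : dyad (m + p) (k * 2 ^ p) = dyad m k.
Proof.
by rewrite /dyad natrM natr_pow2 exprD invfM mulrACA divff ?mulr1 ?gt_eqF ?pow2_gt0.
Qed.

Lemma dfloor_itv m t : 0 <= t -> dyad m (dfloor m t) <= t < dyad m (dfloor m t).+1.
Proof.
move=> t0; rewrite /dyad ler_pdivrMr ?pow2_gt0// ltr_pdivlMr ?pow2_gt0//.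
by apply: truncn_itv; rewrite mulr_ge0// exprn_ge0.
Qed.

Lemma dfloor_le m t : 0 <= t -> dyad m (dfloor m t) <= t.
Proof. by move=> /(dfloor_itv m)/andP[]. Qed.

Lemma dfloor_gt m t : 0 <= t -> t - 2 ^- m < dyad m (dfloor m t).
Proof. by move=> /(dfloor_itv m)/andP[_]; rewrite dyadS ltrBlDr. Qed.

Lemma leq_dfloor m k t : 0 <= t -> (k <= dfloor m t)%N = (dyad m k <= t).
Proof.
move=> t0; have /andP[h1 h2] := dfloor_itv m t0.
apply/idP/idP => [kt|kt]; first by rewrite (le_trans _ h1)// ler_dyad.
by rewrite -ltnS -(ltr_dyad m) (le_lt_trans kt).
Qed.

Lemma dfloor_mono m t s : 0 <= t -> t <= s -> (dfloor m t <= dfloor m s)%N.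
Proof.
by move=> t0 ts; rewrite leq_dfloor ?(le_trans t0)// (le_trans _ ts)// dfloor_le.
Qed.

Lemma dfloor_dyad m k : dfloor m (dyad m k) = k.
Proof.
apply/eqP; rewrite eqn_leq leq_dfloor ?dyad_ge0// lexx andbT.
by rewrite -(ler_dyad m) dfloor_le// dyad_ge0.
Qed.

Lemma dfloor0 m : dfloor m 0 = 0%N.
Proof. by rewrite -(dyad0 m) dfloor_dyad. Qed.

Lemma dfloor1 m : dfloor m 1 = (2 ^ m)%N.
Proof. by rewrite -{1}(dyad_full m) dfloor_dyad. Qed.

Lemma dfloor_le_pow m t : 0 <= t <= 1 -> (dfloor m t <= 2 ^ m)%N.
Proof. by move=> /andP[t0 t1]; rewrite -dfloor1 dfloor_mono. Qed.

Lemma dfloor_refine m p k : dfloor (m + p) (dyad m k) = (k * 2 ^ p)%N.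
Proof. by rewrite -(dyad_refine m p) dfloor_dyad. Qed.

Lemma dfloorS m t : 0 <= t ->
  ((dfloor m t).*2 <= dfloor m.+1 t <= (dfloor m t).*2.+1)%N.
Proof.
move=> t0; have /andP[h1 h2] := dfloor_itv m t0.
have h k : dyad m.+1 k.*2 = dyad m k.
  by rewrite -addn1 -muln2 -[X in (_ * X)%N]expn1 dyad_refine.
rewrite leq_dfloor// h h1/=.
by rewrite -ltnS -doubleS -(ltr_dyad m.+1) h (le_lt_trans _ h2)// dfloor_le.
Qed.

Lemma dfloor_sub m t s : 0 <= t -> t <= s ->
  ((dfloor m s - dfloor m t)%N%:R : R) <= (s - t) * 2 ^+ m + 1.
Proof.
move=> t0 ts; have s0 := le_trans t0 ts.
rewrite natrB ?dfloor_mono//.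
have := dfloor_le m s0; rewrite /dyad ler_pdivrMr ?pow2_gt0//.
have := dfloor_itv m t0 => /andP[_]; rewrite /dyad ltr_pdivlMr ?pow2_gt0//.
rewrite -natr1; nra.
Qed.

Lemma exists_pow2_lt (e : R) : 0 < e -> exists m, 2 ^- m < e.
Proof.
move=> e0; exists (Num.truncn e^-1).+1; rewrite -[ltRHS]invrK.
rewrite ltf_pV2 ?posrE ?invr_gt0 ?pow2_gt0//.
have ev0 : 0 < e^-1 by rewrite invr_gt0.
have /andP[_ h] := truncn_itv (ltW ev0).
by rewrite (lt_le_trans h)// -natr_pow2 ler_nat ltnW// ltn_expl.
Qed.

Lemma pow2V_le m p : (m <= p)%N -> 2 ^- p <= 2 ^- m :> R.
Proof. by move=> mp; rewrite lef_pV2 ?posrE ?pow2_gt0// ler_weXn2l// ler1n. Qed.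

Lemma dfloor_cvg t : 0 <= t -> dyad m (dfloor m t) @[m --> \oo] --> t.
Proof.
move=> t0; apply/cvgrPdist_lt => e e0; have [m0 m0e] := exists_pow2_lt e0.
exists m0 => // m /= m0m; rewrite ger0_norm ?subr_ge0 ?dfloor_le//.
have := dfloor_gt m t0; have := pow2V_le m0m; lra.
Qed.

End Dyadic.

Arguments dyad {R} m k.

(** With [b = 2 ^ p] this passes from the cells of level [m] to their subcells of level [m + p]: the
    subcell [i] lies in the cell [i %/ 2 ^ p]. *)
Lemma sum_block (R : zmodType) (b n : nat) (S : pred nat) (F : nat -> R) :
  (0 < b)%N ->
  \sum_(0 <= k < n | S k) \sum_(k * b <= i < k.+1 * b) F i =
  \sum_(0 <= i < n * b | S (i %/ b)%N) F i.
Proof.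
move=> b0; elim: n => [|n IH]; first by rewrite mul0n !big_geq.
rewrite big_mkcond big_nat_recr//= -big_mkcond/= IH.
rewrite [RHS](big_cat_nat (n := (n * b)%N))//=; last first.
  by rewrite leq_mul2r leqnSn orbT.
congr (_ + _); rewrite [RHS]big_nat_cond.
rewrite [RHS](eq_bigl (fun i => S n && (n * b <= i < n.+1 * b)%N)); last first.
  move=> i; rewrite andbC; have [/andP[i1 i2]|] := boolP (n * b <= i < n.+1 * b)%N.
    rewrite !andbT; congr (S _).
    by apply/eqP; rewrite eqn_leq -ltnS ltn_divLR// i2 leq_divRL.
  by rewrite !andbF.
case: (S n) => /=; first by rewrite -big_nat.
by rewrite big_pred0_eq.
Qed.

(** * Extension of paths to the real line *)

Section Ext.
Context {R : realType}.

Definition clamp (t : R) : R := Num.max 0 (Num.min 1 t).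

Lemma clamp_mem t : clamp t \in unit_itv R.
Proof.
by rewrite inE/= /unit_itv/= in_itv/= /clamp le_max lexx/= ge_max ler01 ge_min lexx.
Qed.

Definition ipt (t : R) : unit_itv R := exist _ (clamp t) (clamp_mem t).

Lemma val_ipt t : val (ipt t) = clamp t. Proof. by []. Qed.

Lemma unit_itvP (t : unit_itv R) : 0 <= val t <= 1.
Proof. by have := valP t; rewrite inE/= /unit_itv/= in_itv. Qed.

Lemma clamp_id t : 0 <= t <= 1 -> clamp t = t.
Proof. by move=> /andP[t0 t1]; rewrite /clamp min_r// max_r. Qed.

Lemma clamp_itv t : 0 <= clamp t <= 1.
Proof. by rewrite -val_ipt unit_itvP. Qed.

Lemma clamp_mono s t : s <= t -> clamp s <= clamp t.
Proof.
move=> st; rewrite /clamp; rewrite ge_max !le_max lexx/=.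
by rewrite le_min !ge_min lexx st !orbT.
Qed.

Lemma clamp_lip s t : `|clamp s - clamp t| <= `|s - t|.
Proof.
rewrite /clamp.
case: (leP 1 s) => s1; case: (leP 1 t) => t1;
  rewrite ?(max_r ler01) ?subrr ?normr0//;
  case: (leP 0 s) => s0; case: (leP 0 t) => t0;
  case: (ler0P (s - t)) => st; rewrite ?subrr ?normr0 ?oppr_ge0//;
  try (case: ler0P); lra.
Qed.

Lemma ipt_val (t : unit_itv R) : ipt (val t) = t.
Proof. by apply: val_inj; rewrite val_ipt clamp_id// unit_itvP. Qed.

Lemma ipt0 : ipt 0 = I0.
Proof. by apply: val_inj; rewrite val_ipt clamp_id// lexx ler01. Qed.

Lemma ipt1 : ipt 1 = I1.
Proof. by apply: val_inj; rewrite val_ipt clamp_id// lexx ler01. Qed.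

Lemma clamp_continuous : continuous clamp.
Proof.
move=> t; apply/cvgrPdist_lt => e e0; near=> s.
by rewrite (le_lt_trans (clamp_lip _ _))//; near: s; exact: cvgr_dist_lt.
Unshelve. all: by end_near. Qed.

Lemma ipt_continuous : continuous ipt.
Proof.
by apply: continuous_comp_initial; exact: clamp_continuous.
Qed.

End Ext.

Section PathExt.
Context {R : realType} {d : nat}.
Implicit Types h : pathE R d.

(** Real arguments spare a membership proof at every dyadic point, and constant values outside of
    [0, 1] keep the extension continuous. *)
Definition pext h (t : R) : 'rV[R]_d := h (ipt t).

Lemma pext_val h t : pext h (val t) = h t.
Proof. by rewrite /pext ipt_val. Qed.

Lemma pext_continuous h : continuous (pext h).
Proof.
move=> t; apply: (@continuous_comp _ _ _ ipt h).
  exact: ipt_continuous.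
exact: path_continuous.
Qed.

Lemma pext_valL h t : 0 <= t <= 1 -> valL (h : unit_itv R -> 'rV[R]_d) t = pext h t.
Proof.
move=> t01; have vL (u : unit_itv R) : valL (h : unit_itv R -> 'rV[R]_d) (val u) = h u.
  by rewrite /valL_/= oinv_set_val valK.
by rewrite -[in LHS](clamp_id t01) -val_ipt vL.
Qed.

Lemma enorm_coord (x : 'rV[R]_d) i : `|x 0 i| <= enorm x.
Proof.
rewrite -ler_sqr ?nnegrE ?enorm_ge0// real_normK ?num_real// enorm_sq.
by rewrite (bigD1 i)//= lerDl sumr_ge0// => j _; exact: sqr_ge0.
Qed.

Lemma enorm_le_sum (x : 'rV[R]_d) : enorm x <= \sum_i `|x 0 i|.
Proof.
rewrite -ler_sqr ?nnegrE ?enorm_ge0 ?sumr_ge0// enorm_sq.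
apply: (big_ind2 (fun a b : R => 0 <= b /\ a <= b ^+ 2) _ _ _).2 => //.
- by move=> a1 b1 a2 b2 [? ?] [? ?]; split; [lra|nra].
- by move=> i _; rewrite real_normK ?num_real.
Qed.

Lemma enorm_sum (I : Type) (r : seq I) (P : pred I) (F : I -> 'rV[R]_d) :
  enorm (\sum_(i <- r | P i) F i) <= \sum_(i <- r | P i) enorm (F i).
Proof.
elim/big_rec2: _ => [|i y x _ h]; first by rewrite enorm0.
by rewrite (le_trans (enormD _ _))// lerD2l.
Qed.

Lemma enorm_cvg (T : Type) (F : set_system T) (FF : Filter F) (f : T -> 'rV[R]_d) x :
  f @ F --> x -> enorm (f y) @[y --> F] --> enorm x.
Proof.
move=> fx; apply/cvgrPdist_lt => e e0.
have c0 : 0 < Num.sqrt d%:R + 1 :> R by rewrite ltr_wpDl// sqrtr_ge0.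
have : \forall y \near F, `|x - f y| < e / (Num.sqrt d%:R + 1).
  by move/cvgrPdist_lt: fx; apply; rewrite divr_gt0.
apply: filterS => y; rewrite ltr_pdivlMr// => h.
have h1 : `|enorm x - enorm (f y)| <= enorm (x - f y).
  have h2 := enormD (x - f y) (f y); rewrite subrK in h2.
  have h3 := enormD (f y - x) x; rewrite subrK -(enormN (f y - x)) opprB in h3.
  by rewrite ler_norml; apply/andP; split; lra.
rewrite (le_lt_trans h1)// (le_lt_trans (enorm_le_norm _))//.
by rewrite (le_lt_trans _ h)// mulrC ler_wpM2l// lerDl.
Qed.

End PathExt.

Lemma cvgr_sum (R : realType) (T : Type) (F : set_system T) (FF : Filter F)
    (I : eqType) (r : seq I) (P : pred I) (f : T -> I -> R) (l : I -> R) :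
  (forall i, i \in r -> P i -> f x i @[x --> F] --> l i) ->
  \sum_(i <- r | P i) f x i @[x --> F] --> \sum_(i <- r | P i) l i.
Proof.
elim: r => [|i r IH] fl.
  by rewrite big_nil; under eq_cvg do rewrite big_nil; exact: cvg_cst.
have IH' : \sum_(i <- r | P i) f x i @[x --> F] --> \sum_(i <- r | P i) l i.
  by apply: IH => j jr; apply: fl; rewrite inE jr orbT.
rewrite big_cons; under eq_cvg do rewrite big_cons.
case: ifP => // Pi; apply: cvgD => //; apply: fl => //; exact: mem_head.
Qed.

(** * Dyadic increments *)

Section DyadicSums.
Context {R : realType} {d : nat}.
Implicit Types (g : R -> 'rV[R]_d) (h : pathE R d).

Definition incr g m k : 'rV[R]_d := g (dyad m k.+1) - g (dyad m k).

(** The energy of the polygonal path that agrees with [g] at the points of level [m]. *)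
Definition denergy m g : R := 2 ^+ m * \sum_(0 <= k < 2 ^ m) enorm (incr g m k) ^+ 2.

Definition ncells m (S : pred nat) : R := \sum_(0 <= k < 2 ^ m | S k) 1.

(** Absolute continuity tested on unions of cells of a single level: [ncells m S / 2 ^ m] is the
    total length of the cells that [S] selects. *)
Definition dyadic_ac g := forall e : R, 0 < e -> exists2 delta : R, 0 < delta &
  forall m (S : pred nat), ncells m S < delta * 2 ^+ m ->
    \sum_(0 <= k < 2 ^ m | S k) enorm (incr g m k) < e.

Lemma abs_continuous_dyadic h : abs_continuous h -> dyadic_ac (pext h).
Proof.
move=> hac e e0; have [delta d0 hd] := hac e e0; exists delta => // m S Sd.
(* Listing the selected cells without repetition turns them into the finite disjoint family that
   [abs_continuous] asks for. *)
pose s := [seq k <- index_iota 0 (2 ^ m) | S k].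
have us : uniq s by rewrite filter_uniq// iota_uniq.
have Sn (F : nat -> R) : \sum_(0 <= k < 2 ^ m | S k) F k =
    \sum_(j < size s) F (nth 0%N s j).
  by rewrite -big_filter (big_nth 0%N) big_mkord.
have slt (j : 'I_(size s)) : (nth 0%N s j < 2 ^ m)%N.
  have : nth 0%N s j \in s by rewrite mem_nth.
  by rewrite mem_filter mem_index_iota => /andP[_ /andP[]].
have v0 (j : 'I_(size s)) : clamp (dyad m (nth 0%N s j)) = dyad m (nth 0%N s j) :> R.
  by rewrite clamp_id// dyad_ge0 dyad_le1// ltnW.
have v1 (j : 'I_(size s)) : clamp (dyad m (nth 0%N s j).+1) = dyad m (nth 0%N s j).+1 :> R.
  by rewrite clamp_id// dyad_ge0 dyad_le1.
rewrite Sn; apply: (hd _ (fun j => ipt (dyad m (nth 0%N s j)))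
  (fun j => ipt (dyad m (nth 0%N s j).+1))) => [j||].
- by rewrite !val_ipt v0 v1 ler_dyad.
- move=> i j _ _ [x []] /=; rewrite !v0 !v1 !in_itv/= => /andP[i1 i2] /andP[j1 j2].
  have := lt_trans i1 j2; have := lt_trans j1 i2; rewrite !ltr_dyad !ltnS => ij ji.
  apply/val_inj/eqP; rewrite -(nth_uniq 0%N (ltn_ord i) (ltn_ord j) us).
  by rewrite eqn_leq ij ji.
- rewrite (eq_bigr (fun=> 2 ^- m)); last first.
    by move=> j _; rewrite !val_ipt v0 v1 dyadS addrAC subrr add0r.
  move: Sd; rewrite /ncells Sn -ltr_pdivrMr ?pow2_gt0// mulr_suml.
  by apply: le_lt_trans; apply: ler_sum => j _; rewrite div1r.
Qed.

Lemma denergy_dyadic_ac g c : (forall m, denergy m g <= c) -> dyadic_ac g.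
Proof.
move=> gc e e0.
have c0 : 0 <= c.
  by apply: le_trans (gc 0%N); rewrite mulr_ge0// sumr_ge0// => i _; exact: sqr_ge0.
(* [c + 1] can be divided by even if [c] vanishes. With [delta = e^2 / c1], both sums that come from
   the AM-GM bound below are less than [e / 2]. *)
pose c1 := c + 1; have c10 : 0 < c1 by rewrite ltr_wpDl.
exists (e ^+ 2 / c1); first by rewrite divr_gt0// exprn_gt0.
move=> m S Sd.
(* AM-GM: [x <= e / (2 c1) * 2^m * x^2 + c1 / (2 e) / 2^m] *)
have am k : enorm (incr g m k) <=
    (e / (2 * c1)) * (2 ^+ m * enorm (incr g m k) ^+ 2) + (c1 / (2 * e)) / 2 ^+ m.
  set x := enorm _; have p0 := @pow2_gt0 R m; set p : R := 2 ^+ m in p0 *.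
  rewrite -subr_ge0 (_ : _ - _ =
     (e * p) / (2 * c1) * (x - c1 / (e * p)) ^+ 2); last by field; rewrite !gt_eqF.
  by rewrite mulr_ge0 ?sqr_ge0// divr_ge0 ?mulr_ge0// ltW.
apply: le_lt_trans (ler_sum _ (fun k _ => am k)) _.
rewrite big_split/= -mulr_sumr -mulr_sumr.
have h1 : \sum_(0 <= k < 2 ^ m | S k) enorm (incr g m k) ^+ 2 <=
    \sum_(0 <= k < 2 ^ m) enorm (incr g m k) ^+ 2.
  rewrite [leLHS]big_mkcond; apply: ler_sum => k _.
  by case: ifP => // _; exact: sqr_ge0.
have h2 : e / (2 * c1) * (2 ^+ m * \sum_(0 <= k < 2 ^ m | S k) enorm (incr g m k) ^+ 2)
    < e / 2.
  have -> : e / 2 = e / (2 * c1) * c1 by field; rewrite gt_eqF.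
  rewrite ltr_pM2l ?divr_gt0// ?mulr_gt0//.
  apply: le_lt_trans (_ : c < c1); last by rewrite ltrDl.
  by apply: le_trans (gc m); rewrite /denergy ler_pM2l ?pow2_gt0.
have h3 : \sum_(0 <= k < 2 ^ m | S k) c1 / (2 * e) / 2 ^+ m < e / 2.
  under eq_bigr do rewrite -[X in X / _]mulr1 mulrAC.
  rewrite -mulr_sumr.
  have -> : e / 2 = (c1 / (2 * e) / 2 ^+ m) * (e ^+ 2 / c1 * 2 ^+ m).
    by field; rewrite !gt_eqF.
  by rewrite ltr_pM2l ?divr_gt0// mulr_gt0.
lra.
Qed.

Lemma sum_incr g m p q : (p <= q)%N ->
  \sum_(p <= k < q) incr g m k = g (dyad m q) - g (dyad m p).
Proof. by move=> pq; rewrite (telescope_sumr (fun k => g (dyad m k))). Qed.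

Lemma incr_refine g m p k :
  incr g m k = \sum_(k * 2 ^ p <= i < k.+1 * 2 ^ p) incr g (m + p) i.
Proof. by rewrite sum_incr ?leq_mul2r ?leqnSn ?orbT// !dyad_refine. Qed.

Definition dvar g m (t : R) : R := \sum_(0 <= k < dfloor m t) enorm (incr g m k).

Lemma dvarB g m s t : 0 <= s -> s <= t ->
  dvar g m t - dvar g m s = \sum_(dfloor m s <= k < dfloor m t) enorm (incr g m k).
Proof.
move=> s0 st; rewrite /dvar (big_cat_nat (n := dfloor m s) (p := dfloor m t))//=.
  by rewrite addrAC subrr add0r.
exact: dfloor_mono.
Qed.

Lemma dvar_mono g m s t : 0 <= s -> s <= t -> dvar g m s <= dvar g m t.
Proof.
move=> s0 st; rewrite -subr_ge0 dvarB// sumr_ge0// => k _; exact: enorm_ge0.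
Qed.

Lemma dvar_incr g m s t : 0 <= s -> s <= t ->
  enorm (g (dyad m (dfloor m t)) - g (dyad m (dfloor m s))) <= dvar g m t - dvar g m s.
Proof.
by move=> s0 st; rewrite dvarB// -sum_incr ?dfloor_mono//; exact: enorm_sum.
Qed.

Lemma enorm_incr_refine g m p (S : pred nat) n :
  \sum_(0 <= k < n | S k) enorm (incr g m k) <=
  \sum_(0 <= k < n * 2 ^ p | S (k %/ 2 ^ p)%N) enorm (incr g (m + p) k).
Proof.
rewrite -sum_block ?expn_gt0//; apply: ler_sum => k _.
by rewrite (incr_refine g m p) enorm_sum.
Qed.

Lemma dvar_level g m p t : 0 <= t -> dvar g m t <= dvar g (m + p) t.
Proof.
move=> t0; apply: le_trans (enorm_incr_refine g m p xpredT _) _.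
rewrite /dvar [leRHS](big_cat_nat (n := dfloor m t * 2 ^ p)%N)//=.
  by rewrite lerDl sumr_ge0// => k _; exact: enorm_ge0.
by rewrite leq_dfloor// dyad_refine dfloor_le.
Qed.

(** Between the floors of [s] and [t] there are at most [(t - s) 2^m + 1] cells; the extra cell is
    due to rounding. *)
Lemma dvarB_le g (e delta : R) m s t :
  (forall m (S : pred nat), ncells m S < delta * 2 ^+ m ->
    \sum_(0 <= k < 2 ^ m | S k) enorm (incr g m k) < e) ->
  0 <= s -> s <= t -> t <= 1 -> (t - s) * 2 ^+ m + 1 < delta * 2 ^+ m ->
  dvar g m t - dvar g m s < e.
Proof.
move=> ge s0 st t1 small; have t0 := le_trans s0 st.
have t2 : (dfloor m t <= 2 ^ m)%N by rewrite dfloor_le_pow// t0.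
have E (F : nat -> R) : \sum_(0 <= k < 2 ^ m | (dfloor m s <= k < dfloor m t)%N) F k =
    \sum_(dfloor m s <= k < dfloor m t) F k.
  rewrite [RHS]big_nat [RHS](big_nat_widen _ _ _ _ _ t2) [RHS](big_nat_widenl _ 0%N)//.
  by apply: eq_bigl => k; case: (k < _)%N; case: (_ <= k)%N.
rewrite dvarB// -E; apply: ge; apply: le_lt_trans small.
by rewrite /ncells E sumr_const_nat dfloor_sub.
Qed.

(** On each of [2 ^ m0] cells shorter than [delta / 2], the variation of every finer level is less
    than [1]. The factor two makes room for the extra cell of [dvarB_le]. *)
Lemma dvar_bounded g : dyadic_ac g ->
  exists C : R, forall m t, 0 <= t <= 1 -> dvar g m t <= C.
Proof.
move=> gac; have [delta d0 gd] := gac 1 ltr01.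
have [m0 m0d] : exists m, 2 ^- m < delta / 2 by apply: exists_pow2_lt; rewrite divr_gt0.
have step p j : (j <= 2 ^ m0)%N -> dvar g (m0 + p) (dyad m0 j) <= j%:R.
  elim: j => [|j IH] j2; first by rewrite dyad0 /dvar dfloor0 big_geq.
  have := IH (ltnW j2); rewrite -natr1.
  suff : dvar g (m0 + p) (dyad m0 j.+1) - dvar g (m0 + p) (dyad m0 j) < 1 by lra.
  apply: (dvarB_le gd); rewrite ?dyad_ge0 ?ler_dyad ?dyad_le1//.
  rewrite dyadS addrAC subrr add0r exprD mulrA mulVf ?gt_eqF ?pow2_gt0// mul1r.
  have p1 : 1 <= 2 ^+ p :> R by rewrite exprn_ege1// ler1n.
  have m0p := @pow2_gt0 R m0.
  rewrite -ltr_pdivrMr ?mulr_gt0 ?pow2_gt0//.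
  have -> : (2 ^+ p + 1) / (2 ^+ m0 * 2 ^+ p) = 2 ^- m0 * (1 + 2 ^- p) :> R.
    by field; rewrite !gt_eqF ?pow2_gt0.
  have : 2 ^- p <= 1 :> R by rewrite invf_le1 ?pow2_gt0.
  have : 0 < 2 ^- m0 :> R by rewrite invr_gt0.
  by nra.
exists (2 ^ m0)%:R => m t /andP[t0 t1].
apply: le_trans (dvar_level g m m0 t0) _; rewrite addnC.
apply: le_trans (dvar_mono g _ t0 t1) _.
by have := step m (2 ^ m0)%N (leqnn _); rewrite dyad_full.
Qed.

(** The total variation on [0, t] along dyadic points. [dvar] increases with the level, so that for
    [dyadic_ac g] this supremum is a limit. *)
Definition var g (t : R) : R := sup (range (fun m => dvar g m (clamp t))).

Lemma var_cvg g t : dyadic_ac g -> 0 <= t <= 1 ->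
  dvar g m t @[m --> \oo] --> var g t.
Proof.
move=> gac t01; rewrite /var clamp_id//; apply: nondecreasing_cvgn.
  apply/nondecreasing_seqP => m; rewrite -addn1; apply: dvar_level.
  by have /andP[] := t01.
have [C hC] := dvar_bounded gac; exists C => _ [m _ <-]; exact: hC.
Qed.

Lemma var_clamp g t : var g (clamp t) = var g t.
Proof. by rewrite /var (@clamp_id _ (clamp t))// clamp_itv. Qed.

Lemma var_incr g s t : dyadic_ac g -> continuous g -> 0 <= s -> s <= t -> t <= 1 ->
  enorm (g t - g s) <= var g t - var g s.
Proof.
move=> gac gc s0 st t1; have t0 := le_trans s0 st; have s1 := le_trans st t1.
have gcv u : 0 <= u -> g (dyad m (dfloor m u)) @[m --> \oo] --> g u.
  by move=> u0; apply: (@cvg_comp _ _ _ (fun m => dyad m (dfloor m u)) g);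
     [exact: dfloor_cvg|exact: gc].
have c1 : enorm (g (dyad m (dfloor m t)) - g (dyad m (dfloor m s))) @[m --> \oo]
    --> enorm (g t - g s).
  by apply: enorm_cvg; apply: cvgB; exact: gcv.
have c2 : dvar g m t - dvar g m s @[m --> \oo] --> var g t - var g s.
  by apply: cvgB; apply: var_cvg; rewrite // ?t0 ?s0.
by apply: (ler_cvg_to c1 c2); apply: nearW => m; exact: dvar_incr.
Qed.

Lemma var_mono g s t : dyadic_ac g -> continuous g -> s <= t -> var g s <= var g t.
Proof.
move=> gac gc st; rewrite -(var_clamp g s) -(var_clamp g t) -subr_ge0.
have /andP[s0 _] := @clamp_itv R s; have /andP[_ t1] := @clamp_itv R t.
by apply: le_trans (var_incr gac gc s0 (clamp_mono st) t1); exact: enorm_ge0.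
Qed.

Lemma var_unif g (e : R) : dyadic_ac g -> 0 < e -> exists2 delta : R, 0 < delta &
  forall s t, 0 <= s -> s <= t -> t <= 1 -> t - s < delta -> var g t - var g s <= e.
Proof.
move=> gac e0; have [delta d0 gd] := gac e e0; exists (delta / 2); first by rewrite divr_gt0.
move=> s t s0 st t1 ts; have t0 := le_trans s0 st; have s1 := le_trans st t1.
have [m0 m0d] : exists m, 2 ^- m < delta / 2 by apply: exists_pow2_lt; rewrite divr_gt0.
have c2 : dvar g m t - dvar g m s @[m --> \oo] --> var g t - var g s.
  by apply: cvgB; apply: var_cvg; rewrite // ?t0 ?s0.
apply: (cvgr_to_le c2); exists m0 => // m /= m0m; apply/ltW/(dvarB_le gd) => //.
have h := le_lt_trans (pow2V_le m0m) m0d.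
have p0 := @pow2_gt0 R m.
have h1 : 1 < delta / 2 * 2 ^+ m by rewrite -ltr_pdivrMr// div1r.
have h2 : (t - s) * 2 ^+ m < delta / 2 * 2 ^+ m by rewrite ltr_pM2r.
lra.
Qed.

Lemma ncells_refine m p (S : pred nat) :
  ncells (m + p) (fun k => S (k %/ 2 ^ p)%N) = ncells m S * 2 ^+ p :> R.
Proof.
rewrite /ncells expnD -sum_block ?expn_gt0// mulr_suml; apply: eq_bigr => k _.
by rewrite sumr_const_nat mulSn addnK mul1r natr_pow2.
Qed.

(** At level [m + p] the subcells of the selected cells have the same total length, so that
    [dyadic_ac] bounds their increments by [e] for every [p], and the bound survives the limit in
    [p]. *)
Lemma var_dyadic_ac g (e : R) : dyadic_ac g -> 0 < e -> exists2 delta : R, 0 < delta &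
  forall m (S : pred nat), ncells m S < delta * 2 ^+ m ->
    \sum_(0 <= k < 2 ^ m | S k) (var g (dyad m k.+1) - var g (dyad m k)) <= e.
Proof.
move=> gac e0; have [delta d0 gd] := gac e e0; exists delta => // m S Sd.
have c : \sum_(0 <= k < 2 ^ m | S k)
    (dvar g (m + p) (dyad m k.+1) - dvar g (m + p) (dyad m k)) @[p --> \oo] -->
  \sum_(0 <= k < 2 ^ m | S k) (var g (dyad m k.+1) - var g (dyad m k)).
  apply: cvgr_sum => k; rewrite mem_index_iota => /andP[_ k2] _.
  have cv l : (l <= 2 ^ m)%N -> dvar g (m + p) (dyad m l) @[p --> \oo] --> var g (dyad m l).
    move=> l2; apply: (@cvg_comp _ _ _ (addn m) (fun q => dvar g q (dyad m l))).
      exact: cvg_addnl.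
    by apply: var_cvg; rewrite // dyad_ge0 dyad_le1.
  by apply: cvgB; apply: cv => //; exact: ltnW.
apply: (cvgr_to_le c); apply: nearW => p.
have -> : \sum_(0 <= k < 2 ^ m | S k)
    (dvar g (m + p) (dyad m k.+1) - dvar g (m + p) (dyad m k)) =
    \sum_(0 <= i < 2 ^ (m + p) | S (i %/ 2 ^ p)%N) enorm (incr g (m + p) i).
  rewrite expnD -sum_block ?expn_gt0//; apply: eq_bigr => k _.
  by rewrite dvarB ?dyad_ge0 ?ler_dyad// !dfloor_refine.
apply/ltW/gd; rewrite ncells_refine exprD mulrA ltr_pM2r//; exact: pow2_gt0.
Qed.

(** Rounding the end points down to a fine level turns the intervals into disjoint sets of cells, at
    the price of one extra cell per interval; continuity undoes the rounding in the limit. *)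
Lemma dyadic_ac_abs_continuous h : dyadic_ac (pext h) -> abs_continuous h.
Proof.
move=> hac e e0; have e20 : 0 < e / 2 by rewrite divr_gt0.
have [delta d0 hd] := hac _ e20; exists (delta / 2); first by rewrite divr_gt0.
move=> n a b ab dis small.
have hcv u : 0 <= u -> pext h (dyad m (dfloor m u)) @[m --> \oo] --> pext h u.
  by move=> u0; apply: (@cvg_comp _ _ _ (fun m => dyad m (dfloor m u)) (pext h));
     [exact: dfloor_cvg|exact: pext_continuous].
have a0 j : 0 <= val (a j) by have /andP[] := unit_itvP (a j).
have b1 j : 0 <= val (b j) <= 1 by exact: unit_itvP.
have c : \sum_(j < n) enorm (pext h (dyad m (dfloor m (val (b j)))) -
      pext h (dyad m (dfloor m (val (a j))))) @[m --> \oo] -->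
    \sum_(j < n) enorm (h (b j) - h (a j)).
  apply: cvgr_sum => j _ _; apply: enorm_cvg.
  by rewrite -!pext_val; apply: cvgB; apply: hcv => //; have /andP[] := b1 j.
apply: (@le_lt_trans _ _ (e / 2)); last lra.
apply: (cvgr_to_le c).
(* From this level on, the [n] extra cells have a total length below [delta / 2]. *)
have [m0 m0d] : exists m, 2 ^- m < delta / 2 / n.+1%:R.
  by apply: exists_pow2_lt; rewrite !divr_gt0// ltr0n.
exists m0 => // m /= m0m.
pose S k := [exists j : 'I_n, (dfloor m (val (a j)) <= k < dfloor m (val (b j)))%N].
have E (F : nat -> R) : \sum_(0 <= k < 2 ^ m | S k) F k =
    \sum_(j < n) \sum_(dfloor m (val (a j)) <= k < dfloor m (val (b j))) F k.
  have E1 j : \sum_(dfloor m (val (a j)) <= k < dfloor m (val (b j))) F k =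
      \sum_(0 <= k < 2 ^ m) (if (dfloor m (val (a j)) <= k < dfloor m (val (b j)))%N
         then F k else 0).
    have t2 : (dfloor m (val (b j)) <= 2 ^ m)%N by exact: dfloor_le_pow.
    rewrite -big_mkcond/=.
    rewrite [LHS]big_nat [LHS](big_nat_widen _ _ _ _ _ t2) [LHS](big_nat_widenl _ 0%N)//.
    by apply: eq_bigl => k; case: (k < _)%N; case: (_ <= k)%N.
  under [RHS]eq_bigr do rewrite E1.
  rewrite exchange_big/= big_mkcond/=; apply: eq_bigr => k _.
  case: ifP => [/existsP[j jk]|/negbT/existsPn nS].
    rewrite (bigD1 j)//= jk big1 ?addr0// => i ij.
    case: ifP => // ik; exfalso; move/eqP: ij; apply.
    move: jk ik => /andP[j1 j2] /andP[i1 i2].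
    have in1 l : (dfloor m (val (a l)) <= k)%N -> (k < dfloor m (val (b l)))%N ->
        val (a l) < dyad m k.+1 <= val (b l).
      move=> l1 l2; have /andP[bl0 _] := b1 l; rewrite -leq_dfloor// l2 andbT.
      by rewrite ltNge -leq_dfloor// -ltnNge.
    have /andP[i3 i4] := in1 _ i1 i2; have /andP[j3 j4] := in1 _ j1 j2.
    (* Both intervals contain the points immediately to the left of [dyad m k.+1], so that
       disjointness forces [i = j]. *)
    apply: (dis i j I I).
    pose x := Num.max (val (a i)) (val (a j)).
    have xk : x < dyad m k.+1 by rewrite gt_max i3 j3.
    have mid (u v w y : R) : u <= w -> w < y -> y <= v -> u < (w + y) / 2 /\ (w + y) / 2 < v.
      by move=> *; split; lra.
    by exists ((x + dyad m k.+1) / 2); split => /=; rewrite in_itv/=; apply/andP;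
       apply: mid => //; rewrite le_max lexx ?orbT.
  by rewrite big1// => j _; rewrite (negbTE (nS j)).
apply: (@le_trans _ _ (\sum_(0 <= k < 2 ^ m | S k) enorm (incr (pext h) m k))).
  rewrite E; apply: ler_sum => j _; rewrite -sum_incr; last first.
    by apply: dfloor_mono; [exact: a0|exact: ab].
  exact: enorm_sum.
apply: ltW; apply: hd; rewrite /ncells E.
apply: (@le_lt_trans _ _ (\sum_(j < n) ((val (b j) - val (a j)) * 2 ^+ m + 1))).
  by apply: ler_sum => j _; rewrite sumr_const_nat; exact: dfloor_sub.
rewrite big_split/= -mulr_suml sumr_const card_ord.
have p0 := @pow2_gt0 R m.
have h1 : (\sum_(j < n) (val (b j) - val (a j))) * 2 ^+ m < delta / 2 * 2 ^+ m.
  by rewrite ltr_pM2r.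
have h2 : n%:R < delta / 2 * 2 ^+ m.
  have := le_lt_trans (pow2V_le m0m) m0d.
  rewrite ltr_pdivlMr ?ltr0n// mulrC ltr_pdivrMr// => /(le_lt_trans _); apply.
  by rewrite ler_nat.
lra.
Qed.

End DyadicSums.

(** * Densities *)

Lemma lebesgue_stieltjes_itv (R : realType) (F : cumulative R R) (a b : R) :
  a <= b -> lebesgue_stieltjes_measure F `]a, b]%classic = (F b - F a)%:E.
Proof.
move=> ab; rewrite /lebesgue_stieltjes_measure /measure_extension/=.
by rewrite measurable_mu_extE/= ?wlength_itv_bnd//; exact: is_ocitv.
Qed.

Lemma dyadic_cell (R : realType) m (x : R) : 0 < x -> x <= 1 ->
  exists2 k, (k < 2 ^ m)%N & x \in `]dyad m k, dyad m k.+1].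
Proof.
move=> x0 x1; have /andP[h1 h2] := dfloor_itv m (ltW x0).
have hm : (dfloor m x <= 2 ^ m)%N by rewrite dfloor_le_pow// ltW.
(* Cells are open on the left, so that a point of level [m] belongs to the cell that precedes its
   floor. *)
move: h1; rewrite le_eqVlt => /orP[/eqP E|h1]; last first.
  exists (dfloor m x); last by rewrite in_itv/= h1 ltW.
  by rewrite -(ltr_dyad (R := R) m) (lt_le_trans h1)// dyad_full.
case: (dfloor m x) E hm => [E|k E km].
  by move: x0; rewrite -E dyad0 ltxx.
by exists k => //; rewrite in_itv/= -E ltr_dyad ltnSn lexx.
Qed.

Lemma dyadic_cell_nested (R : realType) m p k l (x : R) :
  x \in `]dyad m k, dyad m k.+1] -> x \in `]dyad (m + p) l, dyad (m + p) l.+1] ->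
  `]dyad (m + p) l, dyad (m + p) l.+1] `<=` `]dyad m k, dyad m k.+1 : R].
Proof.
rewrite !in_itv/= -!(dyad_refine m p) => /andP[x1 x2] /andP[x3 x4].
have := lt_le_trans x1 x4; have := lt_le_trans x3 x2; rewrite !ltr_dyad ltnS => h1 h2.
move=> y /=; rewrite !in_itv/= => /andP[y1 y2]; apply/andP; split.
  by apply: le_lt_trans y1; rewrite ler_dyad.
by apply: (le_trans y2); rewrite ler_dyad.
Qed.

(** The bound on cells is the epsilon-delta form of the domination of the Stieltjes measure by
    Lebesgue measure; the density is the Radon-Nikodym derivative. *)
Lemma stieltjes_density (R : realType) (F : R -> R) :
  {homo F : s t / s <= t} -> right_continuous F ->
  (forall e : R, 0 < e -> exists2 delta : R, 0 < delta &
    forall m (S : pred nat), ncells m S < delta * 2 ^+ m ->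
      \sum_(0 <= k < 2 ^ m | S k) (F (dyad m k.+1) - F (dyad m k)) <= e) ->
  exists f : R -> R, [/\ forall x, 0 <= f x,
    (@lebesgue_measure R).-integrable [set: R] (EFin \o f) &
    forall a b, 0 <= a -> a <= b -> b <= 1 ->
      (F b - F a)%:E = (\int[lebesgue_measure]_(x in `]a, b]) (f x)%:E)%E].
Proof.
move=> Fnd Frc Fac.
pose Fc : cumulative R R := HB.pack F (isCumulative.Build R _ R F Fnd Frc).
pose mu := lebesgue_stieltjes_measure Fc.
have muE a b : a <= b -> mu `]a, b]%classic = (F b - F a)%:E.
  by move=> ab; rewrite /mu lebesgue_stieltjes_itv.
(* [Fac] only speaks of [0, 1], and the restricted measure is finite. *)
have mD : measurable (`]0, 1]%classic : set (measurableTypeR R)).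
  exact: measurable_itv.
pose nu0 := mrestr mu mD.
have nu0fin : fin_num_fun nu0.
  move=> A mA; rewrite ge0_fin_numE//; apply: (@le_lt_trans _ _ (mu `]0, 1]%classic)).
    by rewrite /nu0 /mrestr; apply: le_measure; rewrite ?inE//; exact: measurableI.
  by rewrite muE// ltry.
pose nu : {finite_measure set (measurableTypeR R) -> \bar R} :=
  HB.pack nu0 (Measure_isFinite.Build _ _ _ nu0 nu0fin).
(* A null set lies in an open set of small measure, which is the increasing
   union of the dyadic cells that it contains. *)
have dom : nu `<< (@lebesgue_measure R).
  apply/null_content_dominatesP => A mA A0.
  apply/eqP; rewrite eq_le measure_ge0 andbT; apply/lee_addgt0Pr => e e0.
  rewrite add0e; have [delta d0 hd] := Fac e e0.
  have [|U [Uo AU Ud]] := @lebesgue_regularity_outer R A delta mA _ d0.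
    by rewrite A0 ltry.
  have mU : measurable (U : set (measurableTypeR R)) by exact: open_measurable.
  have Ud' : (lebesgue_measure U < delta%:E)%E.
    have -> : U = (U `\` A) `|` A by rewrite setUC setDUK.
    rewrite (le_lt_trans (measureU2 _ _ _))//; last by rewrite A0 adde0.
    exact: measurableD.
  pose cell m k : set (measurableTypeR R) := `]dyad m k, dyad m k.+1]%classic.
  have mcell m k : measurable (cell m k) by exact: measurable_itv.
  have tcell m : trivIset [set: 'I_(2 ^ m)] (fun k : 'I_(2 ^ m) => cell m k).
    move=> i j _ _ [x []]; rewrite /cell/= !in_itv/= => /andP[i1 i2] /andP[j1 j2].
    have := lt_le_trans i1 j2; have := lt_le_trans j1 i2; rewrite !ltr_dyad !ltnS => ij ji.
    by apply/val_inj/eqP; rewrite eqn_leq ij ji.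
  pose S m k := `[< cell m k `<=` U >].
  pose UU m := \big[setU/set0]_(k < 2 ^ m | S m k) cell m k.
  have UUP m x : UU m x <-> exists k, [/\ (k < 2 ^ m)%N, cell m k `<=` U & cell m k x].
    rewrite /UU big_mkcond/=.
    rewrite -(bigcup_mkord _ (fun k => if S m k then cell m k else set0)).
    split => [[k /= k2]|[k [k2 Sk xk]]].
      by case: ifPn => // /asboolP Sk xk; exists k.
    by exists k => //; case: ifPn => // /asboolP.
  have mUU m : measurable (UU m) by exact: bigsetU_measurable.
  have UU_mono m : UU m `<=` UU m.+1.
    move=> x /UUP[k [k2 kU xk]]; apply/UUP.
    have [||l l2 xl] := @dyadic_cell R m.+1 x.
    - by move: xk; rewrite /cell/= in_itv/= => /andP[+ _]; apply: le_lt_trans; exact: dyad_ge0.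
    - move: xk; rewrite /cell/= in_itv/= => /andP[_ xk]; apply: (le_trans xk).
      exact: dyad_le1.
    exists l; split => //; apply: subset_trans kU.
    by move: xl; rewrite -addn1 => xl; apply: (dyadic_cell_nested xk xl).
  have sumS (m : nat) (G : nat -> R) :
      (\sum_(k < 2 ^ m | S m k) (G k)%:E = (\sum_(0 <= k < 2 ^ m | S m k) G k)%:E)%E.
    by rewrite sumEFin big_mkord.
  have : (mu (\bigcup_m UU m) <= e%:E)%E.
    have cv : mu (UU m) @[m --> \oo] --> mu (\bigcup_m UU m).
      apply: nondecreasing_cvg_mu => //; first exact: bigcup_measurable.
      apply/nondecreasing_seqP => m; apply/subsetPset; exact: UU_mono.
    rewrite -(cvg_lim _ cv)//; apply: lime_le; first by apply/cvg_ex; exists (mu (\bigcup_m UU m)).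
    apply: nearW => m; rewrite [leLHS](measure_bigsetU_ord mu)//.
    rewrite (eq_bigr (fun k : 'I_(2 ^ m) => (F (dyad m k.+1) - F (dyad m k))%:E)); last first.
      by move=> k _; apply: muE; rewrite ler_dyad.
    rewrite (sumS m (fun k => F (dyad m k.+1) - F (dyad m k))) lee_fin.
    (* The cells of [UU m] are disjoint and lie in [U], so that their total length is less than
       [delta]. *)
    apply: hd; rewrite -ltr_pdivrMr ?pow2_gt0//.
    have -> : ncells m (S m) / 2 ^+ m = \sum_(0 <= k < 2 ^ m | S m k) 2 ^- m :> R.
      by rewrite /ncells mulr_suml; under eq_bigr do rewrite mul1r.
    rewrite -lte_fin -(sumS m (fun=> 2 ^- m)).
    apply: le_lt_trans Ud'.
    have -> : (\sum_(k < 2 ^ m | S m k) (2 ^- m)%:E =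
        lebesgue_measure (UU m) :> \bar R)%E.
      rewrite [RHS](measure_bigsetU_ord (@lebesgue_measure R))//; apply: eq_bigr => k _.
      have := lebesgue_measure_itv `]dyad m k, dyad m k.+1 : R].
      rewrite /= lte_fin ltr_dyad ltnSn -EFinB dyadS addrAC subrr add0r => <-.
      by rewrite /cell dyadS.
    apply: le_measure; rewrite ?inE// => x /UUP[k [_ kU xk]]; exact: kU.
  apply: le_trans; apply: le_measure; rewrite ?inE//.
  - exact: measurableI.
  - exact: bigcup_measurable.
  move=> x [/= Ax]; rewrite in_itv/= => /andP[x0 x1].
  have : nbhs x U by apply: open_nbhs_nbhs; split => //; exact: AU.
  move=> /nbhs_ballP[r /= r0 rU]; have [m mr] := exists_pow2_lt r0.
  exists m => //; apply/UUP; have [k k2 xk] := dyadic_cell m x0 x1.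
  exists k; split => // y; move: xk; rewrite /cell/= !in_itv/= dyadS => /andP[x2 x3] /andP[y2 y3].
  by apply: rU; rewrite /ball/= ltr_norml; apply/andP; split; lra.
have [f [f0 ffin fint fE]] := radon_nikodym_sigma_finite dom.
have ff : EFin \o (fine \o f) = f by apply/funext => x /=; rewrite fineK.
exists (fine \o f); split => [x||a b a0 ab b1].
- exact: fine_ge0.
- by rewrite ff.
- transitivity (nu `]a, b]%classic).
    rewrite -(muE _ _ ab); transitivity (mu (`]a, b]%classic `&` `]0, 1]%classic)) => //.
    congr (mu _); apply/esym/setIidl => x /=; rewrite !in_itv/= => /andP[ax xb].
    by rewrite (le_lt_trans a0 ax) (le_trans xb b1).
  rewrite fE; last exact: measurable_itv.
  by apply: eq_integral => x _; rewrite /= fineK.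
Qed.

Section Density.
Context {R : realType} {d : nat}.
Implicit Types (h : pathE R d).
Local Notation leb := (@lebesgue_measure R).

Lemma var_continuous (g : R -> 'rV[R]_d) : dyadic_ac g -> continuous g ->
  continuous (var g).
Proof.
move=> gac gc t; apply/cvgrPdist_le => e e0.
have [delta d0 hd] := var_unif gac e0.
near=> s; have st : `|t - s| < delta by near: s; exact: cvgr_dist_lt.
rewrite -(var_clamp g s) -(var_clamp g t).
have c := le_lt_trans (clamp_lip t s) st.
have /andP[s0 s1] := @clamp_itv R s; have /andP[t0 t1] := @clamp_itv R t.
have [ts|/ltW ts] := leP (clamp s) (clamp t).
  rewrite ger0_norm ?subr_ge0 ?var_mono//; apply: hd => //.
  by rewrite (le_lt_trans (ler_norm _) c).
rewrite distrC ger0_norm ?subr_ge0 ?var_mono//; apply: hd => //.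
by rewrite distrC in c; rewrite (le_lt_trans (ler_norm _) c).
Unshelve. all: by end_near. Qed.

Lemma coord_cvg (T : Type) (F : set_system T) (FF : Filter F) (u : T -> 'rV[R]_d)
    (l : 'rV[R]_d) i : u x @[x --> F] --> l -> u x 0 i @[x --> F] --> l 0 i.
Proof. by move=> ul; exact: (cvg_comp _ _ ul (@coord_continuous R 1 d 0 i l)). Qed.

Lemma cvg_coord (T : Type) (F : set_system T) (FF : Filter F) (u : T -> 'rV[R]_d)
    (l : 'rV[R]_d) : (forall i, u x 0 i @[x --> F] --> l 0 i) -> u x @[x --> F] --> l.
Proof.
move=> ul; apply/cvgrPdist_lt => e e0.
have e20 : 0 < e / 2 by rewrite divr_gt0.
have : \forall x \near F, forall i, `|l 0 i - u x 0 i| < e / 2.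
  apply: filter_forall => i; move/cvgrPdist_lt: (ul i); exact.
apply: filterS => x hx; apply: (@le_lt_trans _ _ (e / 2)); last lra.
rewrite [leLHS]mx_normrE; apply/bigmax_leP; split; first exact: ltW.
by move=> [i j] _ /=; rewrite !mxE ord1 ltW.
Qed.

Lemma path_density h : dyadic_ac (pext h) ->
  exists f : 'I_d -> R -> R, forall i,
    leb.-integrable [set: R] (EFin \o f i) /\
    forall a b, 0 <= a -> a <= b -> b <= 1 ->
      pext h b 0 i - pext h a 0 i = (\int[leb]_(x in `]a, b]) f i x)%R.
Proof.
move=> hac; set g := pext h in hac *; have gc : continuous g := @pext_continuous _ _ h.
have gclamp t : g (clamp t) = g t.
  by rewrite /g /pext; congr (h _); apply: val_inj; rewrite !val_ipt clamp_id// clamp_itv.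
have vnd : {homo var g : s t / s <= t} by move=> s t; exact: var_mono.
have [|f0 [f00 if0 f0E]] := stieltjes_density vnd _ (fun e => var_dyadic_ac hac).
  by move=> t; apply: cvg_at_right_filter; exact: var_continuous.
suff H i : exists f : R -> R, leb.-integrable [set: R] (EFin \o f) /\
    forall a b, 0 <= a -> a <= b -> b <= 1 ->
      g b 0 i - g a 0 i = (\int[leb]_(x in `]a, b]) f x)%R.
  have /choice[f hf] := H; by exists f.
(* [var g] and [var g + g_i] are both nondecreasing, so they have densities. *)
pose F t := var g t + g t 0 i.
have Finc s t : 0 <= s -> s <= t -> t <= 1 -> `|g t 0 i - g s 0 i| <= var g t - var g s.
  move=> s0 st t1; apply: le_trans (var_incr hac gc s0 st t1).
  by have := enorm_coord (g t - g s) i; rewrite !mxE.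
have Fnd : {homo F : s t / s <= t}.
  move=> s t st; rewrite /F -(var_clamp g s) -(var_clamp g t) -(gclamp s) -(gclamp t).
  have /andP[s0 s1] := @clamp_itv R s; have /andP[t0 t1] := @clamp_itv R t.
  by have := Finc _ _ s0 (clamp_mono st) t1; rewrite ler_norml => /andP[]; lra.
have [||f1 [f10 if1 f1E]] := stieltjes_density Fnd.
- move=> t; apply: cvg_at_right_filter; apply: cvgD; first exact: var_continuous.
  by apply: coord_cvg; exact: gc.
(* An increment of [F] is at most twice the one of [var g]. *)
- move=> e e0; have e20 : 0 < e / 2 by rewrite divr_gt0.
  have [delta d0 hd] := var_dyadic_ac hac e20; exists delta => // m S Sd.
  apply: (@le_trans _ _ (2 * \sum_(0 <= k < 2 ^ m | S k)
     (var g (dyad m k.+1) - var g (dyad m k)))); last by have := hd m S Sd; lra.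
  rewrite mulr_sumr big_nat_cond [leRHS]big_nat_cond; apply: ler_sum => k /andP[/andP[_ k2] _].
  have := Finc (dyad m k) (dyad m k.+1); rewrite dyad_ge0 ler_dyad leqnSn dyad_le1//.
  by move=> /(_ isT isT isT); rewrite ler_norml /F => /andP[]; lra.
exists (fun x => f1 x - f0 x); split.
  exact: (@integrableB _ _ _ _ setT measurableT _ _ if1 if0).
move=> a b a0 ab b1; have mab : measurable (`]a, b]%classic : set (measurableTypeR R)).
  exact: measurable_itv.
rewrite RintegralB//; [|exact: (integrableS measurableT)..].
by rewrite /Rintegral -f1E// -f0E//= /F; lra.
Qed.

End Density.

(** * Densities and almost everywhere derivatives *)

Section Velocity.
Context {R : realType} {d : nat}.
Implicit Types (h : pathE R d) (f : 'I_d -> R -> R).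
Local Notation leb := (@lebesgue_measure R).

Definition has_density h f := forall i,
  leb.-integrable [set: R] (EFin \o f i) /\
  forall a b, 0 <= a -> a <= b -> b <= 1 ->
    pext h b 0 i - pext h a 0 i = (\int[leb]_(x in `]a, b]) f i x)%R.

Lemma dnbhs0_norm_lt (e : R) : 0 < e -> \forall s \near (0 : R)^', `|s| < e.
Proof.
move=> e0; apply: nbhs_dnbhs; apply/nbhs_ballP; exists e => //= s.
by rewrite /ball/= sub0r normrN.
Qed.

Lemma ae_density_derivative h f : has_density h f ->
  {ae leb, forall t, 0 < t < 1 -> forall i,
    s^-1 * (pext h (s + t) 0 i - pext h t 0 i) @[s --> 0^'] --> f i t}.
Proof.
move=> hf.
suff H i : {ae leb, forall t, 0 < t < 1 ->
    s^-1 * (pext h (s + t) 0 i - pext h t 0 i) @[s --> 0^'] --> f i t}.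
  have : \forall t \ae leb, forall i, 0 < t < 1 ->
    s^-1 * (pext h (s + t) 0 i - pext h t 0 i) @[s --> 0^'] --> f i t.
    exact: (@filter_forall _ _ _ _ (ae_filter_ringOfSetsType leb)).
  by apply: (@filterS _ _ (ae_filter_ringOfSetsType leb)) => t ht t01 i; exact: ht.
have [fi fE] := hf i.
have fi' y : leb.-integrable `]-oo, y] (EFin \o f i).
  by apply: integrableS fi.
have loc : locally_integrable [set: R] (f i).
  by apply: open_integrable_locally => //; exact: openT.
have := FTC1Ny fi' loc.
apply: (@filterS _ _ (ae_filter_ringOfSetsType leb)) => t [dF F't] /andP[t0 t1].
pose F y := (\int[leb]_(t in [set` `]-oo, y]]) (f i t))%R.
have FE a b : 0 <= a -> a <= b -> b <= 1 -> pext h b 0 i - pext h a 0 i = F b - F a.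
  move=> a0 ab b1; rewrite fE// /F Rintegral_itvB//.
have cv : s^-1 *: (F (s + t) - F t) @[s --> 0^'] --> f i t.
  rewrite -F't.
  have E : (fun s => s^-1 *: (F (s + t) - F t)) =
      (fun s => s^-1 *: ((F \o shift t) (s *: 1) - F t)).
    by apply/funext => s /=; rewrite /GRing.scale/= mulr1.
  have : cvg ((fun s => s^-1 *: (F (s + t) - F t)) @ 0^') by rewrite E.
  by [].
apply: cvg_trans cv; apply: near_eq_cvg; near=> s.
have st0 : 0 <= s + t.
  have : `|s| < t by near: s; exact: dnbhs0_norm_lt.
  by rewrite ltr_norml => /andP[]; lra.
have st1 : s + t <= 1.
  have : `|s| < 1 - t by near: s; apply: dnbhs0_norm_lt; rewrite subr_gt0.
  by rewrite ltr_norml => /andP[]; lra.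
suff -> : pext h (s + t) 0 i - pext h t 0 i = F (s + t) - F t by [].
have [s0|s0] := leP 0 s.
  by apply: FE => //; [exact: ltW|lra].
by apply/eqP; rewrite -eqr_opp !opprB; apply/eqP/FE => //; [lra|exact: ltW].
Unshelve. all: by end_near. Qed.

Lemma ae_velocity h f : has_density h f ->
  {ae leb, forall t, 0 < t < 1 -> velocity h t = \row_i f i t}.
Proof.
move=> /ae_density_derivative.
apply: (@filterS _ _ (ae_filter_ringOfSetsType leb)) => t ht /andP[t0 t1].
rewrite /velocity /derive1; apply: cvg_lim => //.
apply: cvg_coord => i; rewrite mxE.
apply: cvg_trans (ht _ i); last by rewrite t0.
apply: near_eq_cvg; near=> s.
rewrite !pext_valL ?mxE//.
  by rewrite ltW// ltW.
have : `|s| < Num.min t (1 - t).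
  near: s; apply: dnbhs0_norm_lt; by rewrite lt_min t0 subr_gt0.
by rewrite lt_min !ltr_norml => /andP[/andP[? ?] /andP[? ?]]; apply/andP; split; lra.
Unshelve. all: by end_near. Qed.

End Velocity.

(** * Integrals of functions known almost everywhere *)

Section IntegralSqueeze.
Context d (T : measurableType d) (R : realType) (mu : {measure set T -> \bar R}).
Local Open Scope ereal_scope.

(** This holds without measurability, since the integral of a nonnegative function is a supremum
    over the simple functions below it. *)
Lemma ge0_integral_mono (f g : T -> \bar R) : (forall x, 0 <= f x) ->
  (forall x, f x <= g x) -> \int[mu]_x f x <= \int[mu]_x g x.
Proof.
move=> f0 fg; rewrite !ge0_integralTE//; last by move=> x; exact: le_trans (fg x).
by apply: le_ereal_sup => _ [h /= hf <-]; exists h => // x; exact: le_trans (fg x).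
Qed.

(* [f] need not be measurable: the velocity of a path is only known almost
   everywhere. *)
Lemma ge0_integral_negligible_eq (D N : set T) (f g : T -> \bar R) :
  measurable D -> measurable_fun D g -> mu.-negligible N ->
  (forall x, 0 <= f x) -> (forall x, 0 <= g x) ->
  (forall x, D x -> ~ N x -> f x = g x) ->
  \int[mu]_(x in D) f x = \int[mu]_(x in D) g x.
Proof.
move=> mD mg [N' [mN' N'0 NN']] f0 g0 fg.
have mgD : measurable_fun setT (g \_ D) by apply/(measurable_restrictT _ _).1.
rewrite integral_mkcond [RHS]integral_mkcond.
(* [gl] and [gu] are measurable, bracket the restriction of [f] everywhere, and differ from that of
   [g] only on the null set [N']. *)
pose gu x := if x \in N' then +oo else (g \_ D) x.
pose gl x := if x \in N' then 0 else (g \_ D) x.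
have gD0 x : 0 <= (g \_ D) x by rewrite patchE; case: ifP.
have mN'b : measurable_fun setT (fun x => x \in N').
  by apply: (measurable_fun_bool true); rewrite setTI preimage_mem_true.
have mgu : measurable_fun setT gu.
  by apply: measurable_fun_ifT.
have mgl : measurable_fun setT gl.
  by apply: measurable_fun_ifT.
have aeN' (k : T -> \bar R) : (forall x, ~ N' x -> k x = (g \_ D) x) -> ae_eq mu setT k (g \_ D).
  move=> kg; exists N'; split => // x /= H; apply: contrapT => N'x; apply: H => _.
  exact: kg.
have Eu : \int[mu]_x gu x = \int[mu]_x (g \_ D) x.
  apply: ge0_ae_eq_integral => //; first by move=> x _; rewrite /gu; case: ifP.
  by apply: aeN' => x N'x; rewrite /gu memNset.
have El : \int[mu]_x gl x = \int[mu]_x (g \_ D) x.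
  apply: ge0_ae_eq_integral => //; first by move=> x _; rewrite /gl; case: ifP.
  by apply: aeN' => x N'x; rewrite /gl memNset.
have fgD x : ~ N' x -> (f \_ D) x = (g \_ D) x.
  move=> N'x; rewrite !patchE; case: ifPn => // /set_mem Dx.
  by apply: fg => // /NN'.
have fD0 x : 0 <= (f \_ D) x by rewrite patchE; case: ifP.
apply/eqP; rewrite eq_le; apply/andP; split.
  rewrite -Eu; apply: ge0_integral_mono => // x; rewrite /gu.
  by case: ifPn => [_|/negP]; [exact: leey|rewrite inE => /fgD ->].
rewrite -El; apply: ge0_integral_mono => [x|x]; rewrite /gl; case: ifPn => //.
by move=> /negP; rewrite inE => /fgD ->.
Qed.

End IntegralSqueeze.

Lemma limn_esup_le (R : realType) (u : (\bar R)^nat) (l : \bar R) :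
  (\forall n \near \oo, (u n <= l)%E) -> (limn_esup u <= l)%E.
Proof.
move=> ul; apply: (@le_trans _ _ (ereal_sup (u @` [set n | (u n <= l)%E]))).
  by apply: ereal_inf_lbound; exists [set n | (u n <= l)%E].
by apply: ge_ereal_sup => _ [n /= ? <-].
Qed.

Lemma limn_einf_ge (R : realType) (u : (\bar R)^nat) (l : \bar R) :
  (\forall n \near \oo, (l <= u n)%E) -> (l <= limn_einf u)%E.
Proof.
move=> ul; rewrite -leeN2 -limn_esupN; apply: limn_esup_le.
by apply: filterS ul => n /=; rewrite leeN2.
Qed.

Lemma trivIset_dyadic_cells (R : realType) m :
  trivIset [set: nat] (fun k => `]dyad m k, dyad m k.+1 : R]%classic).
Proof.
move=> i j _ _ [x []] /=; rewrite !in_itv/= => /andP[i1 i2] /andP[j1 j2].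
have := lt_le_trans i1 j2; have := lt_le_trans j1 i2; rewrite !ltr_dyad !ltnS => ij ji.
by apply/eqP; rewrite eqn_leq ij ji.
Qed.

(** The cell that contains [t] need not have [t] as an end point. The errors of the linear
    approximation at [a] and [b] are at most [e (t - a)] and [e (b - t)], which add up to
    [e (b - a)]. *)
Lemma straddled_slope (R : realType) (phi : R -> R) (t v e : R) :
  s^-1 * (phi (s + t) - phi t) @[s --> 0^'] --> v -> 0 < e ->
  exists2 delta, 0 < delta & forall a b, a <= t -> t <= b -> a < b -> b - a < delta ->
    `|(phi b - phi a) / (b - a) - v| <= e.
Proof.
move=> /cvgrPdist_le phiv e0; have := phiv e e0.
move=> /nbhs_ballP[delta /= d0 hd]; exists delta => // a b at_ tb ab small.
have lin s : `|s| < delta -> `|phi (s + t) - phi t - s * v| <= e * `|s|.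
  have [->|s0 sd] := eqVneq s 0; first by rewrite add0r subrr mul0r subr0 !normr0 mulr0.
  have := hd s; rewrite /ball/= sub0r normrN => /(_ sd s0) h.
  have -> : phi (s + t) - phi t - s * v = - s * (v - s^-1 * (phi (s + t) - phi t)).
    by field.
  by rewrite normrM normrN mulrC ler_wpM2r.
have l1 := lin (b - t); have l2 := lin (a - t).
rewrite !subrK in l1 l2.
have nb : `|b - t| = b - t by rewrite ger0_norm// subr_ge0.
have na : `|a - t| = t - a by rewrite distrC ger0_norm// subr_ge0.
rewrite nb na in l1 l2.
have b1 : b - t < delta by lra.
have a1 : t - a < delta by lra.
have {}l1 := l1 b1; have {}l2 := l2 a1.
have ba : 0 < b - a by rewrite subr_gt0.
have -> : (phi b - phi a) / (b - a) - v =
  ((phi b - phi t - (b - t) * v) - (phi a - phi t - (a - t) * v)) / (b - a).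
  by field; rewrite gt_eqF.
rewrite normrM normfV (gtr0_norm ba) ler_pdivrMr//.
by apply: le_trans (ler_normB _ _) _; lra.
Qed.

(** * Energy and dyadic energies *)

Section Energy.
Context {R : realType} {d : nat}.
Implicit Types (h : pathE R d) (f : 'I_d -> R -> R).
Local Notation leb := (@lebesgue_measure R).

Lemma sqr_integral_le (f : R -> R) (a b : R) : a < b ->
  leb.-integrable `]a, b] (EFin \o f) ->
  (((\int[leb]_(x in `]a, b]) f x)%R ^+ 2 / (b - a))%:E <=
    \int[leb]_(x in `]a, b]) (f x ^+ 2)%:E)%E.
Proof.
move=> ab fi.
have mab : measurable (`]a, b]%classic : set (measurableTypeR R)).
  exact: measurable_itv.
have mf : measurable_fun `]a, b] f.
  by have /integrableP[/measurable_EFinP] := fi.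
have mf2 : measurable_fun `]a, b] (EFin \o (fun x => f x ^+ 2)).
  by apply/measurable_EFinP; exact: measurable_funX.
have [oo|fin] := leP +oo%E (\int[leb]_(x in `]a, b]) (f x ^+ 2)%:E)%E.
  by move: oo; rewrite leye_eq => /eqP ->; rewrite leey.
have f2i : leb.-integrable `]a, b] (EFin \o (fun x => f x ^+ 2)).
  apply/integrableP; split => //.
  by under eq_integral do rewrite /= ger0_norm ?sqr_ge0//.
have ba : 0 < b - a by rewrite subr_gt0.
(* Integrate [f ^ 2 >= 2 * c * f - c ^ 2] with [c] the mean of [f]. *)
set I := (\int[leb]_(x in `]a, b]) f x)%R; pose c := I / (b - a).
have lab : leb `]a, b]%classic = (b - a)%:E.
  by rewrite lebesgue_measure_itv/= lte_fin ab EFinB.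
have ci : leb.-integrable `]a, b] (EFin \o (fun x => 2 * c * f x)).
  have := @integrableZl _ _ _ leb _ mab (2 * c) _ fi.
  by apply: eq_integrable => // x _.
have cc : leb.-integrable `]a, b] (EFin \o (fun=> c ^+ 2)).
  by apply/integrableP; split; [exact: measurable_cst|
     rewrite integral_cst//= lab ltry].
have li : leb.-integrable `]a, b] (EFin \o (fun x => 2 * c * f x - c ^+ 2)).
  by have := @integrableB _ _ _ leb _ mab _ _ ci cc; apply: eq_integrable.
have <- : (\int[leb]_(x in `]a, b]) (2 * c * f x - c ^+ 2)%:E = (I ^+ 2 / (b - a))%:E)%E.
  have -> : I ^+ 2 / (b - a) = (\int[leb]_(x in `]a, b]) (2 * c * f x - c ^+ 2))%R.
    rewrite RintegralB// RintegralZl//.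
    have -> : (\int[leb]_(x in `]a, b]) c ^+ 2)%R = c ^+ 2 * (b - a).
      by rewrite /Rintegral integral_cst//= lab.
    rewrite -/I.
    by rewrite /c; field; rewrite gt_eqF.
  by rewrite /Rintegral fineK//; exact: integrable_fin_num.
apply: le_integral => // x _; rewrite lee_fin -subr_ge0.
by have := sqr_ge0 (f x - c); rewrite sqrrB; lra.
Qed.

Lemma energy_density h f : has_density h f ->
  energy h = (\int[leb]_(t in unit_itv R) (\sum_i f i t ^+ 2)%:E)%E.
Proof.
move=> hf; have mu01 : measurable (unit_itv R : set (measurableTypeR R)).
  exact: measurable_itv.
have mfi i D : measurable_fun D (f i).
  by have [/integrableP[/measurable_EFinP mfi _] _] := hf i; exact: measurable_funTS.
have mG D : measurable_fun D (fun t => (\sum_i f i t ^+ 2)%:E).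
  by apply/measurable_EFinP; apply: measurable_sum => i; exact: measurable_funX.
(* The derivative is controlled at interior points only, so both end points join the exceptional
   set. *)
rewrite /energy; apply: (@ge0_integral_negligible_eq _ _ _ leb (unit_itv R)
  ([set t | ~ (0 < t < 1 -> velocity h t = \row_i f i t)] `|` [set 0; 1])) => //.
- exact: mG.
- apply: negligibleU; first exact: ae_velocity.
  have n1 (x : R) : leb.-negligible [set x].
    by exists [set x]; split => //; exact: lebesgue_measure_set1.
  exact: negligibleU.
- by move=> x; rewrite lee_fin sqr_ge0.
- by move=> x; rewrite lee_fin sumr_ge0// => i _; exact: sqr_ge0.
move=> t; rewrite /unit_itv/= in_itv/= => /andP[t0 t1] /not_orP[/contrapT tv /not_orP[tn0 tn1]].
rewrite tv; last first.
  by rewrite !lt_neqAle t0 t1 !andbT eq_sym; apply/andP; split; apply/eqP.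
by rewrite enorm_sq; congr EFin; apply: eq_bigr => i _; rewrite mxE.
Qed.

Lemma denergy_le_density h f m : has_density h f ->
  ((denergy m (pext h))%:E <= \int[leb]_(t in unit_itv R) (\sum_i f i t ^+ 2)%:E)%E.
Proof.
move=> hf; pose cell k : set (measurableTypeR R) := `]dyad m k, dyad m k.+1]%classic.
have mcell k : measurable (cell k) by exact: measurable_itv.
have mu01 : measurable (unit_itv R : set (measurableTypeR R)).
  exact: measurable_itv.
have mfi i D : measurable_fun D (f i).
  by have [/integrableP[/measurable_EFinP mfi _] _] := hf i; exact: measurable_funTS.
have mG D : measurable_fun D (fun t => (\sum_i f i t ^+ 2)%:E).
  by apply/measurable_EFinP; apply: measurable_sum => i; exact: measurable_funX.
have G0 t : (0 <= (\sum_i f i t ^+ 2)%:E)%E.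
  by rewrite lee_fin sumr_ge0// => i _; exact: sqr_ge0.
have mf2 i D : measurable_fun D (fun t => (f i t ^+ 2)%:E).
  by apply/measurable_EFinP; exact: measurable_funX.
pose U := \big[setU/set0]_(k <- index_iota 0 (2 ^ m)) cell k.
have mU : measurable U by exact: bigsetU_measurable.
apply: (@le_trans _ _ (\int[leb]_(t in U) (\sum_i f i t ^+ 2)%:E)%E); last first.
  apply: ge0_subset_integral => //; first exact: mG.
  rewrite /U => t; rewrite -bigcup_seq => -[k /=]; rewrite mem_index_iota => /andP[_ k2].
  rewrite /cell /unit_itv/= !in_itv/= => /andP[tk1 tk2].
  by rewrite (le_trans _ (ltW tk1)) ?dyad_ge0// (le_trans tk2)// dyad_le1.
rewrite ge0_integral_bigsetU//; first last.
- exact: mG.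
- move=> i j _ _; exact: (@trivIset_dyadic_cells R m i j I I).
- exact: iota_uniq.
rewrite /denergy mulr_sumr -sumEFin big_seq [leRHS]big_seq.
apply: lee_sum => k; rewrite mem_index_iota => /andP[_ k2].
rewrite (_ : (fun t => (\sum_i f i t ^+ 2)%:E) = (fun t => (\sum_i (f i t ^+ 2)%:E)%E)); last first.
  by apply/funext => t; rewrite sumEFin.
rewrite ge0_integral_sum//; last 2 first.
- by move=> i; exact: mf2.
- by move=> i x _; rewrite lee_fin sqr_ge0.
rewrite enorm_sq mulr_sumr -sumEFin; apply: lee_sum => i _.
have [fi fE] := hf i.
rewrite !mxE fE ?dyad_ge0 ?ler_dyad ?dyad_le1//.
have := @sqr_integral_le (f i) (dyad m k) (dyad m k.+1).
rewrite ltr_dyad ltnSn => /(_ isT) H.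
apply: le_trans (H _); last exact: (integrableS measurableT).
by rewrite lee_fin dyadS addrAC subrr add0r invrK mulrC.
Qed.

Lemma in_H_denergy h m : in_H h -> ((denergy m (pext h))%:E <= energy h)%E.
Proof.
move=> [/abs_continuous_dyadic/path_density[f hf] _].
by rewrite (energy_density hf); exact: denergy_le_density.
Qed.

Lemma density_le_denergy h f (c : R) : has_density h f ->
  (forall m, denergy m (pext h) <= c) ->
  (\int[leb]_(t in unit_itv R) (\sum_i f i t ^+ 2)%:E <= c%:E)%E.
Proof.
move=> hf hc; pose cell m k : set (measurableTypeR R) := `]dyad m k, dyad m k.+1]%classic.
have mcell m k : measurable (cell m k) by exact: measurable_itv.
have mu01 : measurable (unit_itv R : set (measurableTypeR R)).
  exact: measurable_itv.
have mfi i D : measurable_fun D (f i).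
  by have [/integrableP[/measurable_EFinP mfi _] _] := hf i; exact: measurable_funTS.
have mG D : measurable_fun D (fun t => (\sum_i f i t ^+ 2)%:E).
  by apply/measurable_EFinP; apply: measurable_sum => i; exact: measurable_funX.
have G0 t : (0 <= (\sum_i f i t ^+ 2)%:E)%E.
  by rewrite lee_fin sumr_ge0// => i _; exact: sqr_ge0.
(* The squared speed of the polygonal path of level [m]: its integral is the dyadic energy, and it
   converges almost everywhere to the squared norm of the density. *)
pose s m t : R := \sum_(0 <= k < 2 ^ m)
  (enorm (2 ^+ m *: incr (pext h) m k) ^+ 2 * \1_(cell m k) t).
have mind m k D : measurable_fun D (\1_(cell m k) : R -> R).
  by apply: measurable_indic; exact: mcell.
have s0 m t : 0 <= s m t.
  by rewrite /s sumr_ge0// => k _; rewrite mulr_ge0// sqr_ge0.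
have ms m D : measurable_fun D (EFin \o s m).
  apply/measurable_EFinP; apply: measurable_sum => k; apply: measurable_funM => //.
have sI m : (\int[leb]_(t in unit_itv R) (s m t)%:E = (denergy m (pext h))%:E)%E.
  rewrite (_ : (fun t => (s m t)%:E) = (fun t => (\sum_(0 <= k < 2 ^ m)
     (enorm (2 ^+ m *: incr (pext h) m k) ^+ 2 * \1_(cell m k) t)%:E)%E)); last first.
    by apply/funext => t; rewrite sumEFin.
  rewrite ge0_integral_sum//; last 2 first.
  - move=> k; apply/measurable_EFinP; apply: measurable_funM => //.
  - by move=> k x _; rewrite lee_fin mulr_ge0// sqr_ge0.
  rewrite /denergy mulr_sumr -sumEFin big_seq [RHS]big_seq.
  apply: eq_bigr => k; rewrite mem_index_iota => /andP[_ k2].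
  rewrite (@integralZl_indic _ _ _ leb _ mu01 (fun=> cell m k))//; last first.
    by move=> /lt_geF; rewrite sqr_ge0.
  rewrite integral_indic// setIidl; last first.
    move=> x; rewrite /cell /unit_itv/= !in_itv/= => /andP[x1 x2].
    by rewrite (le_trans _ (ltW x1)) ?dyad_ge0// (le_trans x2)// dyad_le1.
  transitivity ((enorm (2 ^+ m *: incr (pext h) m k) ^+ 2)%:E * (2 ^- m)%:E)%E.
    congr (_ * _)%E; have := lebesgue_measure_itv `]dyad m k, dyad m k.+1 : R].
    by rewrite /= lte_fin ltr_dyad ltnSn -EFinB dyadS addrAC subrr add0r => <-; rewrite /cell dyadS.
  rewrite -EFinM; congr EFin; rewrite !enorm_sq mulr_suml mulr_sumr.
  apply: eq_bigr => i _; rewrite mxE exprMn.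
  by field; rewrite gt_eqF ?pow2_gt0.
have scv t : 0 < t < 1 -> (forall i,
    u^-1 * (pext h (u + t) 0 i - pext h t 0 i) @[u --> 0^'] --> f i t) ->
    s m t @[m --> \oo] --> \sum_i f i t ^+ 2.
  move=> /andP[t0 t1] ht.
  have /choice[kf kfP] : forall m, exists k, (k < 2 ^ m)%N /\ t \in `]dyad m k, dyad m k.+1].
    by move=> m; have [k k2 tk] := dyadic_cell m t0 (ltW t1); exists k.
  have sE m : s m t = \sum_i ((pext h (dyad m (kf m).+1) 0 i - pext h (dyad m (kf m)) 0 i) /
      (dyad m (kf m).+1 - dyad m (kf m))) ^+ 2.
    have [k2 tk] := kfP m.
    rewrite /s (bigD1_seq (kf m)) ?mem_index_iota ?k2 ?iota_uniq//=.
    rewrite big1 ?addr0; last first.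
      move=> j jk; rewrite indicE memNset ?mulr0// => tj.
      move/eqP: jk; apply; apply: (@trivIset_dyadic_cells R m) => //.
      by exists t; split => //; exact: tj.
    rewrite indicE mem_set// mulr1 enorm_sq; apply: eq_bigr => i _.
    by rewrite !mxE dyadS [in X in _ / X]addrAC subrr add0r invrK mulrC.
  rewrite (_ : (fun m => s m t) = (fun m => \sum_i ((pext h (dyad m (kf m).+1) 0 i -
      pext h (dyad m (kf m)) 0 i) / (dyad m (kf m).+1 - dyad m (kf m))) ^+ 2)); last exact/funext.
  apply: cvgr_sum => i _ _.
  suff ci : (pext h (dyad m (kf m).+1) 0 i - pext h (dyad m (kf m)) 0 i) /
      (dyad m (kf m).+1 - dyad m (kf m)) @[m --> \oo] --> f i t.
    exact: (cvg_comp _ _ ci (@sqr_continuous R (f i t))).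
  apply/cvgrPdist_le => e e0.
  have [delta d0 hd] := straddled_slope (phi := fun u => pext h u 0 i) (ht i) e0.
  have [m0 m0d] := exists_pow2_lt d0; exists m0 => // m /= m0m.
  have [k2] := kfP m; rewrite in_itv/= => /andP[t2 t3].
  rewrite distrC; apply: hd; rewrite ?ltr_dyad//; first exact: ltW.
  by rewrite dyadS addrAC subrr add0r; exact: le_lt_trans (pow2V_le m0m) m0d.
(* The limit inferior is defined also where the slopes fail to converge, and Fatou's lemma applies
   to it directly. *)
rewrite -(@ge0_integral_negligible_eq _ _ _ leb (unit_itv R)
  ([set t | ~ (0 < t < 1 -> forall i,
    u^-1 * (pext h (u + t) 0 i - pext h t 0 i) @[u --> 0^'] --> f i t)] `|` [set 0; 1])
  (fun t => limn_einf (fun m => (s m t)%:E))) => //; first last.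
- move=> t; rewrite /unit_itv/= in_itv/= => /andP[t0 t1] /not_orP[/contrapT tv /not_orP[tn0 tn1]].
  have t01 : 0 < t < 1.
    by rewrite !lt_neqAle t0 t1 !andbT eq_sym; apply/andP; split; apply/eqP.
  have : (s m t)%:E @[m --> \oo] --> (\sum_i f i t ^+ 2)%:E.
    by apply: cvg_EFin; [exact: nearW|exact: scv (tv t01)].
  by move=> /cvg_limn_einf_sup[].
- by move=> t; apply: limn_einf_ge; apply: nearW => m; rewrite lee_fin.
- apply: negligibleU; first exact: ae_density_derivative.
  have n1 (x : R) : leb.-negligible [set x].
    by exists [set x]; split => //; exact: lebesgue_measure_set1.
  exact: negligibleU.
- exact: mG.
apply: le_trans (fatou _ _ _ _) _ => //.
- by move=> m; exact: ms.
- by move=> m x _; rewrite lee_fin.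
apply: le_trans (limn_einf_sup _) _; apply: limn_esup_le; apply: nearW => m.
by rewrite sI lee_fin.
Qed.

Lemma denergy_in_H h (c : R) : (forall m, denergy m (pext h) <= c) ->
  in_H h /\ (energy h <= c%:E)%E.
Proof.
move=> hc; have hac := denergy_dyadic_ac hc; have [f hf] := path_density hac.
have ec : (energy h <= c%:E)%E.
  by rewrite (energy_density hf); exact: density_le_denergy hf hc.
split => //; split; first exact: dyadic_ac_abs_continuous.
by rewrite (le_lt_trans ec)// ltry.
Qed.

End Energy.

(** * Gaussian estimates *)

Section Gaussian.
Context {R : realType}.
Local Notation leb := (@lebesgue_measure R).

(* The density of standard deviation [s] is compared with the one of standard
   deviation [K * s], whose integral is at most one. *)
Lemma normal_prob_tail (s K x : R) (B : set R) : 0 < s -> 1 < K -> 0 <= x ->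
  measurable B -> (forall t, B t -> x <= `|t|) ->
  (normal_prob 0 s B <= (K * expR (- ((1 - K ^- 2) * x ^+ 2 / (2 * s ^+ 2))))%:E)%E.
Proof.
move=> s0 K1 x0 mB Bx; have K0 : 0 < K by apply: lt_trans K1.
set C := K * expR _; have C0 : 0 <= C by rewrite mulr_ge0 ?expR_ge0 ?ltW.
have sn : s != 0 by rewrite gt_eqF.
have Ksn : K * s != 0 by rewrite mulf_neq0// gt_eqF.
have mpdf sg : measurable_fun [set: R] (normal_pdf 0 sg) by exact: measurable_normal_pdf.
have mpdfE (sg : R) (D : set R) : measurable_fun D (fun t => (normal_pdf 0 sg t)%:E).
  by apply/measurable_EFinP; exact: measurable_funTS.
have mCpdfE (D : set R) : measurable_fun D (fun t => (C * normal_pdf 0 (K * s) t)%:E).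
  by apply/measurable_EFinP; apply: measurable_funM => //; exact: measurable_funTS.
have KE : K * normal_peak (K * s) = normal_peak s.
  rewrite /normal_peak exprMn -mulrA -mulrnAr sqrtrM ?sqr_ge0// sqrtr_sqr gtr0_norm//.
  by rewrite invfM mulrA divff ?mul1r// gt_eqF.
(* The ratio of the two densities is [K * expR (- (1 - K^-2) t^2 / (2 s^2))], which decreases in
   [|t|]. *)
have pdf_le t : B t -> normal_pdf 0 s t <= C * normal_pdf 0 (K * s) t.
  move=> Bt; rewrite !normal_pdfE// /C mulrACA KE -[in leLHS]KE KE.
  rewrite ler_wpM2l ?normal_peak_ge0// /normal_fun -expRD ler_expR !subr0.
  have xt : x ^+ 2 <= t ^+ 2.
    by rewrite -[t ^+ 2]real_normK ?num_real// ler_sqr ?nnegrE//; exact: Bx.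
  have -> : - t ^+ 2 / (s ^+ 2 *+ 2) = - ((1 - K ^- 2) * t ^+ 2 / (2 * s ^+ 2)) +
      - t ^+ 2 / ((K * s) ^+ 2 *+ 2).
    by field; rewrite sn gt_eqF.
  rewrite lerD2r lerN2 ler_pM2r; last by rewrite invr_gt0 mulr_gt0// exprn_gt0.
  rewrite ler_wpM2l// subr_ge0 invf_le1 ?exprn_gt0//.
  by rewrite exprn_ege1// ltW.
apply: (@le_trans _ _ (\int[leb]_(t in B) (C * normal_pdf 0 (K * s) t)%:E)%E).
  apply: ge0_le_integral => //=.
  - by move=> t _; rewrite lee_fin normal_pdf_ge0.
  - exact: mpdfE.
  - exact: mCpdfE.
apply: (@le_trans _ _ (\int[leb]_t (C * normal_pdf 0 (K * s) t)%:E)%E).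
  apply: ge0_subset_integral => //.
    exact: mCpdfE.
  by move=> t _; rewrite lee_fin mulr_ge0// normal_pdf_ge0.
under eq_integral do rewrite EFinM.
rewrite ge0_integralZl//; last 2 first.
- exact: mpdfE.
- by move=> t _; rewrite lee_fin normal_pdf_ge0.
by rewrite integral_normal_pdf mule1.
Qed.

(** The length of the interval times the smallest value of the density on it, taken at distance
    [|a| + r] from the origin. *)
Lemma normal_prob_itv_ge (s a r : R) : 0 < s -> 0 < r ->
  ((2 * r * normal_peak s * expR (- ((`|a| + r) ^+ 2 / (2 * s ^+ 2))))%:E <=
    normal_prob 0 s `[(a - r)%R, (a + r)%R]%classic)%E.
Proof.
move=> s0 r0; have sn : s != 0 by rewrite gt_eqF.
set c := normal_peak s * expR (- ((`|a| + r) ^+ 2 / (2 * s ^+ 2))).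
have mi : measurable (`[(a - r), (a + r)]%classic : set (measurableTypeR R)).
  exact: measurable_itv.
have mpdfE (D : set R) : measurable_fun D (fun t => (normal_pdf 0 s t)%:E).
  by apply/measurable_EFinP; apply: measurable_funTS; exact: measurable_normal_pdf.
have -> : (2 * r * normal_peak s * expR (- ((`|a| + r) ^+ 2 / (2 * s ^+ 2))))%:E =
    (\int[leb]_(t in `[(a - r)%R, (a + r)%R]) (cst c%:E) t)%E.
  rewrite integral_cst//= lebesgue_measure_itv/= lte_fin ifT; last by lra.
  by rewrite -EFinD -EFinM; congr EFin; rewrite /c; ring.
apply: ge0_le_integral => //=.
- by move=> t _; rewrite lee_fin mulr_ge0 ?normal_peak_ge0 ?expR_ge0.
- exact: mpdfE.
move=> t; rewrite in_itv/= => /andP[t1 t2]; rewrite lee_fin normal_pdfE// /c.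
rewrite ler_wpM2l ?normal_peak_ge0// /normal_fun ler_expR subr0 mulNr lerN2.
have -> : s ^+ 2 *+ 2 = 2 * s ^+ 2 by rewrite mulr_natl.
rewrite ler_pM2r; last by rewrite invr_gt0 mulr_gt0// exprn_gt0.
rewrite -[t ^+ 2]real_normK ?num_real// ler_sqr ?nnegrE ?addr_ge0 ?(ltW r0)//.
rewrite ler_norml; have := ler_norm a; have := ler_norm (- a); rewrite normrN.
by move=> h1 h2; apply/andP; split; lra.
Qed.

End Gaussian.

(** * Compact sets of paths *)

Lemma continuous_modulus (R : realType) (V : normedModType R) (X : topologicalType)
    (v : X -> R) (g : X -> V) : continuous v ->
  (forall e : R, 0 < e -> exists2 delta : R, 0 < delta &
    forall s t, `|v s - v t| <= delta -> `|g s - g t| < e) ->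
  continuous g.
Proof.
move=> vc gv t; apply/cvgrPdist_lt => e e0; have [delta d0 hd] := gv e e0.
by move/cvgrPdist_le: (vc t) => /(_ delta d0); apply: filterS => s; exact: hd.
Qed.

Lemma ultra_cvg_compact (T : Type) (U : topologicalType) (F : set_system T) (f : T -> U)
    (C : set U) : UltraFilter F -> compact C -> F (f @^-1` C) ->
  exists2 p, C p & f x @[x --> F] --> p.
Proof.
move=> FU cC FC; have FP : ProperFilter F by exact: ultra_proper.
have [p [Cp clp]] := cC (f @ F) _ FC; exists p => // V Vp.
have [//|FV] := in_ultra_setVsetC (f @^-1` V) FU.
have [y [/= nVy Vy]] := clp (~` V) V FV Vp.
by [].
Qed.

Section HolderSet.
Context {R : realType} {d : nat}.
Implicit Types (h : pathE R d).

Lemma sup_dist_le (f g : pathE R d) (e : R) :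
  (forall t, enorm (f t - g t) <= e) -> sup_dist f g <= e.
Proof.
move=> fge; apply: ge_sup; first by have [] := sup_dist_has_sup f g.
by move=> _ [t _ <-].
Qed.

Lemma enorm_le_coord (x : 'rV[R]_d) (c : R) : (forall i, `|x 0 i| <= c) ->
  enorm x <= d%:R * c.
Proof.
move=> xc; apply: le_trans (enorm_le_sum _) _.
apply: (@le_trans _ _ (\sum_(i < d) c)); first by apply: ler_sum => i _.
by rewrite sumr_const card_ord mulr_natl.
Qed.

Lemma pext_unif h (e : R) : 0 < e -> exists m0, forall m, (m0 <= m)%N ->
  forall s t, 0 <= s <= 1 -> `|s - t| <= 2 ^- m -> enorm (pext h s - pext h t) <= e.
Proof.
move=> e0; have /compact_near_coveringP := @segment_compact R 0 1.
pose P (m : nat) (s : R) := forall t, `|s - t| <= 2 ^- m -> enorm (pext h s - pext h t) <= e.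
move=> /(_ nat \oo P _)[].
  move=> x _.
  have cx : enorm (pext h y - pext h x) @[y --> x] --> (0 : R).
    rewrite -[X in _ --> X](@enorm0 R d) -(subrr (pext h x)); apply: enorm_cvg.
    by apply: cvgB; [exact: pext_continuous|exact: cvg_cst].
  have e20 : 0 < e / 2 by rewrite divr_gt0.
  have /nbhs_ballP[r /= r0 hr] : \forall y \near x, enorm (pext h y - pext h x) < e / 2.
    move/cvgrPdist_lt: cx => /(_ _ e20); apply: filterS => y.
    by rewrite sub0r normrN ger0_norm ?enorm_ge0.
  have r20 : 0 < r / 2 by rewrite divr_gt0.
  have [m0 m0r] := exists_pow2_lt r20.
  exists (ball x (r / 2), [set m | (m0 <= m)%N]).
    by split; [exact: nbhsx_ballx|exists m0].
  move=> [s m] [/= xs m0m] t st.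
  have hs : enorm (pext h s - pext h x) < e / 2.
    by apply: hr; move: xs; rewrite /ball/=; lra.
  have ht : enorm (pext h t - pext h x) < e / 2.
    apply: hr; rewrite /ball/= -[x - t](subrKA s) (le_lt_trans (ler_normD _ _))//.
    have := le_trans st (pow2V_le m0m).
    by move: xs; rewrite /ball/=; lra.
  rewrite -[pext h s - _](subrKA (pext h x)) (le_trans (enormD _ _))//.
  by rewrite -[pext h x - _]opprB enormN; lra.
move=> m0 _ hm0; exists m0 => m m0m s t s01 st; by apply: (hm0 m).
Qed.

(* Any ratio strictly between [sqrt (1 / 2)] and [1] could replace [3 / 4]: the
   standard deviation of the increments of level [l] is [sqrt (1 / 2) ^ l]. *)
Definition holder_set (a : R) : set (pathE R d) := [set h : pathE R d | h I0 = 0 /\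
  forall l k i, (k < 2 ^ l)%N -> `|incr (pext h) l k 0 i| <= a * (3 / 4) ^+ l].

(** From level [n] to level [n + 1] the floor of [t] moves by at most one cell of level [n + 1]. The
    factor [3] is the sum of [(3 / 4) ^ j] over [j >= 1], and the bound is a partial sum of this
    series. *)
Lemma holder_chain a h m p (t : R) i : 0 <= a -> holder_set a h -> 0 <= t <= 1 ->
  `|pext h (dyad (m + p) (dfloor (m + p) t)) 0 i - pext h (dyad m (dfloor m t)) 0 i|
    <= 3 * a * (3 / 4) ^+ m * (1 - (3 / 4) ^+ p).
Proof.
move=> a0 [_ hh] /andP[t0 t1].
elim: p => [|p IH]; first by rewrite addn0 !subrr normr0 mulr0.
rewrite addnS; set n := (m + p)%N in IH *.
have step : `|pext h (dyad n.+1 (dfloor n.+1 t)) 0 i - pext h (dyad n (dfloor n t)) 0 i|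
    <= a * (3 / 4) ^+ n.+1.
  have E : dyad n (dfloor n t) = dyad n.+1 (dfloor n t).*2 :> R.
    by rewrite -(dyad_refine n 1) addn1 expn1 muln2.
  have /andP[l1 l2] := dfloorS n t0.
  have [le|gt] := leqP (dfloor n.+1 t) (dfloor n t).*2.
    have -> : dfloor n.+1 t = (dfloor n t).*2 by apply/eqP; rewrite eqn_leq le l1.
    by rewrite -E subrr normr0 mulr_ge0// exprn_ge0// divr_ge0.
  have F : dfloor n.+1 t = (dfloor n t).*2.+1 by apply/eqP; rewrite eqn_leq l2 gt.
  rewrite E F; have := hh n.+1 (dfloor n t).*2 i.
  rewrite -F /incr !mxE F; apply.
  by rewrite -ltnS -F ltnS dfloor_le_pow// t0.
have := ler_normD (pext h (dyad n.+1 (dfloor n.+1 t)) 0 i - pext h (dyad n (dfloor n t)) 0 i)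
  (pext h (dyad n (dfloor n t)) 0 i - pext h (dyad m (dfloor m t)) 0 i).
rewrite subrKA => /le_trans; apply; apply: le_trans (lerD step IH) _.
rewrite le_eqVlt; apply/orP; left; apply/eqP.
by rewrite /n exprS exprD exprS; field.
Qed.

Lemma holder_floor a h m (t : R) i : 0 <= a -> holder_set a h -> 0 <= t <= 1 ->
  `|pext h t 0 i - pext h (dyad m (dfloor m t)) 0 i| <= 3 * a * (3 / 4) ^+ m.
Proof.
move=> a0 ah t01; have /andP[t0 t1] := t01.
have c : `|pext h (dyad (m + p) (dfloor (m + p) t)) 0 i - pext h (dyad m (dfloor m t)) 0 i|
    @[p --> \oo] --> `|pext h t 0 i - pext h (dyad m (dfloor m t)) 0 i|.
  apply: cvg_norm; apply: cvgB; last exact: cvg_cst.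
  apply: coord_cvg.
  apply: (@cvg_comp _ _ _ (addn m) (fun n => pext h (dyad n (dfloor n t)))).
    exact: cvg_addnl.
  apply: (@cvg_comp _ _ _ (fun n => dyad n (dfloor n t)) (pext h)).
    exact: dfloor_cvg.
  exact: pext_continuous.
apply: (cvgr_to_le c); apply: nearW => p.
apply: le_trans (holder_chain m p i a0 ah t01) _.
rewrite ler_piMr ?mulr_ge0// ?exprn_ge0 ?divr_ge0//.
Qed.

(** [7 = 3 + 1 + 3]: each point costs a chain to its floor, and the two floors are equal or
    adjacent. The factor [d] passes from coordinates to the Euclidean norm. *)
Lemma holder_modulus a h m (s t : R) : 0 <= a -> holder_set a h ->
  0 <= s <= 1 -> 0 <= t <= 1 -> `|s - t| <= 2 ^- m ->
  enorm (pext h s - pext h t) <= d%:R * (7 * a * (3 / 4) ^+ m).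
Proof.
wlog st : s t / s <= t => [H|].
  move=> a0 ah s01 t01; have [st|/ltW ts] := leP s t; first exact: H.
  by rewrite distrC -enormN opprB; exact: H.
move=> a0 ah s01 t01 small; have /andP[s0 s1] := s01; have /andP[t0 t1] := t01.
apply: enorm_le_coord => i; rewrite !mxE.
have hs := holder_floor m i a0 ah s01; have ht := holder_floor m i a0 ah t01.
have mid : `|pext h (dyad m (dfloor m s)) 0 i - pext h (dyad m (dfloor m t)) 0 i|
    <= a * (3 / 4) ^+ m.
  have : (dfloor m t <= (dfloor m s).+1)%N.
    rewrite -ltnS -(ltr_dyad (R := R) m) (le_lt_trans (dfloor_le m t0))//.
    have := dfloor_itv m s0 => /andP[_]; rewrite [dyad m (dfloor m s).+2]dyadS.
    move: small; rewrite distrC ger0_norm ?subr_ge0//; lra.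
  rewrite leq_eqVlt ltnS => /orP[/eqP E|le].
    rewrite E distrC; have [_ hh] := ah; have := hh m (dfloor m s) i.
    by rewrite !mxE; apply; rewrite -E dfloor_le_pow.
  have -> : dfloor m t = dfloor m s by apply/eqP; rewrite eqn_leq le dfloor_mono.
  by rewrite subrr normr0 mulr_ge0// exprn_ge0// divr_ge0.
have := ler_normD (pext h s 0 i - pext h (dyad m (dfloor m s)) 0 i)
  (pext h (dyad m (dfloor m s)) 0 i - pext h (dyad m (dfloor m t)) 0 i).
have := ler_normD (pext h s 0 i - pext h (dyad m (dfloor m t)) 0 i)
  (pext h (dyad m (dfloor m t)) 0 i - pext h t 0 i).
rewrite !subrKA; rewrite distrC in ht; lra.
Qed.

(** Arzela-Ascoli with ultrafilters: bounded values make an ultrafilter converge at each time, the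
    common modulus makes the limit continuous, and it turns convergence at finitely many grid points
    into uniform convergence. *)
Lemma compact_holder_set (a : R) : 0 <= a -> compact (holder_set a).
Proof.
move=> a0; rewrite compact_ultra => F FU Fa; have FP : ProperFilter F by exact: ultra_proper.
(* Level [0] of the modulus, applied from the starting value [0], bounds all values of a path. *)
pose M : R := d%:R * (7 * a).
pose C : set 'rV[R]_d := [set v | forall i, `[- M, M]%classic (v ord0 i)].
have cC : compact C.
  by apply: (@rV_compact R d (fun=> `[- M, M]%classic)) => i; exact: segment_compact.
have FC t : F ((fun h : pathE R d => h t) @^-1` C).
  apply: filterS Fa => h ah i; rewrite /= in_itv/= -ler_norml.
  apply: le_trans (enorm_coord _ _) _.
  have := holder_modulus (m := 0%N) a0 ah (unit_itvP t) (unit_itvP I0).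
  have [h0 _] := ah; rewrite !pext_val h0 !subr0 !expr0 invr1 mulr1; apply.
  have /andP[t0 t1] := unit_itvP t; by rewrite ger0_norm.
have /choice[g gP] : forall t, exists p : 'rV[R]_d, (fun h : pathE R d => h t) h @[h --> F] --> p.
  by move=> t; have [p _ hp] := ultra_cvg_compact FU cC (FC t); exists p.
have gmod m (s t : unit_itv R) : `|val s - val t| <= 2 ^- m ->
    enorm (g s - g t) <= d%:R * (7 * a * (3 / 4) ^+ m).
  move=> st; have c : enorm ((h : pathE R d) s - h t) @[h --> F] --> enorm (g s - g t).
    by apply: enorm_cvg; apply: cvgB; exact: gP.
  apply: (cvgr_to_le c); apply: filterS Fa => h ah; rewrite -!pext_val.
  by apply: holder_modulus => //; exact: unit_itvP.
have smallm (e : R) : 0 < e -> exists m, d%:R * (7 * a * (3 / 4) ^+ m) < e.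
  move=> e0; have : d%:R * (7 * a * (3 / 4) ^+ m) @[m --> \oo] --> (0 : R).
    rewrite -[X in _ --> X](mulr0 d%:R); apply: cvgMr.
    rewrite -[X in _ --> X](mulr0 (7 * a)); apply: cvgMr.
    by apply: cvg_expr; rewrite ger0_norm; lra.
  move/cvgrPdist_lt => /(_ e e0)[m _ hm]; exists m.
  have := hm m (leqnn m); rewrite sub0r normrN; exact: le_lt_trans (ler_norm _).
have gc : continuous g.
  apply: (@continuous_modulus R 'rV[R]_d (unit_itv R) (fun t => val t) g).
    exact: initial_continuous.
  move=> e e0; have [m me] := smallm e e0.
  exists (2 ^- m); first by rewrite invr_gt0 pow2_gt0.
  move=> s t st; apply: le_lt_trans me; apply: le_trans (gmod m s t st).
  rewrite [leLHS]mx_normrE; apply/bigmax_leP; split; first exact: enorm_ge0.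
  by move=> [i j] _ /=; rewrite ord1; exact: enorm_coord.
pose G : pathE R d := (mkcts gc : continuousType _ _).
have GE t : G t = g t by [].
exists G; split.
  split.
    have c : enorm ((h : pathE R d) I0) @[h --> F] --> enorm (g I0) by exact: enorm_cvg.
    apply/enorm_eq0/le_anti; rewrite enorm_ge0 andbT; apply: (cvgr_to_le c).
    by apply: filterS Fa => h [-> _]; rewrite enorm0.
  move=> l k i k2.
  have c : `|incr (pext (h : pathE R d)) l k 0 i| @[h --> F] --> `|incr (pext G) l k 0 i|.
    by apply: cvg_norm; apply: coord_cvg; apply: cvgB; exact: gP.
  apply: (cvgr_to_le c); apply: filterS Fa => h [_ hh]; exact: hh.
apply/cvg_ballP => e e0.
have e40 : 0 < e / 4 by rewrite divr_gt0.
have [m me] := smallm _ e40.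
have : \forall h \near F, forall k : 'I_(2 ^ m).+1,
    enorm (g (ipt (dyad m k)) - (h : pathE R d) (ipt (dyad m k))) < e / 4.
  apply: filter_forall => k.
  have : enorm (g (ipt (dyad m k)) - (h : pathE R d) (ipt (dyad m k))) @[h --> F] --> (0 : R).
    rewrite -[X in _ --> X](@enorm0 R d) -(subrr (g (ipt (dyad m k)))).
    by apply: enorm_cvg; apply: cvgB; [exact: cvg_cst|exact: gP].
  move/cvgrPdist_lt => /(_ _ e40); apply: filterS => h.
  by rewrite sub0r normrN ger0_norm ?enorm_ge0.
move=> gridF; near=> h.
have ah : holder_set a h by near: h.
have gh : forall k : 'I_(2 ^ m).+1,
    enorm (g (ipt (dyad m k)) - h (ipt (dyad m k))) < e / 4 by near: h.
rewrite ballEmdist /=; apply: (@le_lt_trans _ _ (3 * (e / 4))); last lra.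
apply: sup_dist_le => t; rewrite GE; have /andP[t0 t1] := unit_itvP t.
pose u : unit_itv R := ipt (dyad m (dfloor m (val t))).
have uE : val u = dyad m (dfloor m (val t)).
  by rewrite val_ipt clamp_id// dyad_ge0 dyad_le1// dfloor_le_pow// t0.
have tu : `|val t - val u| <= 2 ^- m.
  rewrite uE ger0_norm ?subr_ge0 ?dfloor_le//.
  by have := dfloor_gt m t0; lra.
have h1 := gmod m t u tu.
have h2 : enorm (h u - h t) <= d%:R * (7 * a * (3 / 4) ^+ m).
  have -> : h u - h t = pext h (val u) - pext h (val t) by rewrite !pext_val.
  by apply: holder_modulus => //; rewrite ?unit_itvP// distrC.
have kb : (dfloor m (val t) < (2 ^ m).+1)%N by rewrite ltnS dfloor_le_pow// t0.
have h3 := gh (Ordinal kb); rewrite /= -/u in h3.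
have -> : g t - h t = (g t - g u) + (g u - h u) + (h u - h t).
  by rewrite !addrA subrK addrC !addrA subrK addrC.
apply: le_trans (enormD _ _) _; apply: le_trans (lerD (enormD _ _) (lexx _)) _.
lra.
Unshelve. all: by end_near. Qed.

End HolderSet.

(** * Brownian paths *)

Lemma measure_big_setU_le d (T : measurableType d) (R : realType)
    (mu : {measure set T -> \bar R}) (I : Type) (s : seq I) (F : I -> set T) :
  (forall i, measurable (F i)) ->
  (mu (\big[setU/set0]_(i <- s) F i) <= \sum_(i <- s) mu (F i))%E.
Proof.
move=> mF; elim: s => [|i s IH]; first by rewrite !big_nil measure0.
rewrite !big_cons; apply: le_trans (measureU2 _ _ _) _ => //.
  exact: bigsetU_measurable.
exact: leeD2l.
Qed.

Lemma measurable_gt_set d (T : measurableType d) (R : realType) (f : T -> R) (x : R) :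
  measurable_fun [set: T] f -> measurable [set w | x < f w].
Proof.
move=> mf; rewrite (_ : [set w | x < f w] = f @^-1` `]x, +oo[%classic); last first.
  by apply/seteqP; split => w /=; rewrite in_itv/= andbT.
rewrite -[X in measurable X]setTI; apply: mf => //; exact: measurable_itv.
Qed.

(** * Measurability of path events *)

Section PathMeasurability.
Context {R : realType} {d : nat} {disp : measure_display} {Omega : measurableType disp}.
Variable V : Omega -> pathE R d.
Hypothesis mV : forall t i, measurable_fun [set: Omega] (fun w => V w t 0 i).

(* A dyadic level, the values of a path at the points of that level, and an
   integer [n] standing for the radius [1 / n.+1]. *)
Let code : Type := (nat * seq {ffun 'I_d -> rat} * nat)%type.

(** The paths close to a step function with rational values. Only dyadic times are tested, which
    makes this a countable intersection of conditions on coordinates. *)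
Let cyl (c : code) : set (pathE R d) := [set h : pathE R d | forall l k i,
  `|pext h (dyad l k) 0 i -
    ratr (nth [ffun=> 0] c.1.2 (dfloor c.1.1 (clamp (dyad l k : R))) i)| <= c.2.+1%:R^-1].

Let measurable_cyl c : measurable (V @^-1` cyl c).
Proof.
have -> : V @^-1` cyl c = \bigcap_l \bigcap_k \bigcap_(i in [set: 'I_d]) [set w |
    `|pext (V w) (dyad l k) 0 i -
    ratr (nth [ffun=> 0] c.1.2 (dfloor c.1.1 (clamp (dyad l k : R))) i)| <= c.2.+1%:R^-1].
  apply/seteqP; split => [w Vw l _ k _ i _|w Vw l k i]; first exact: Vw.
  exact: (Vw l I k I i I).
apply: bigcapT_measurable => l; apply: bigcapT_measurable => k.
apply: fin_bigcap_measurable => // i _; rewrite -[X in measurable X]setTI.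
apply: measurable_fun_le => //.
by apply: measurableT_comp => //; apply: measurable_funB => //; exact: mV.
Qed.

(** The space of paths is separable: an open set is the union of the coded sets that it contains,
    and there are countably many codes. *)
Lemma measurable_path_preimage (A : set (pathE R d)) : open A -> measurable (V @^-1` A).
Proof.
move=> oA.
have -> : A = \bigcup_c (if `[< cyl c `<=` A >] then cyl c else set0).
  apply/seteqP; split => [h Ah|h [c _]]; last by case: asboolP => // + hc; exact.
  have /nbhs_ballP[e /= e0 he] : nbhs h A by apply: open_nbhs_nbhs.
  (* Two paths in one coded set differ by at most [2 / n.+1] in each coordinate, hence by at most
     [2 d / n.+1] in norm. *)
  have [n ne] : exists n : nat, 2 * (d%:R * n.+1%:R^-1) < e.
    pose n := Num.truncn (2 * d%:R / e); exists n.
    have h0 : 0 <= 2 * d%:R / e by rewrite divr_ge0 ?(ltW e0)// mulr_ge0.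
    have /andP[_] := truncn_itv h0; rewrite -/n ltr_pdivrMr// mulrA => hn.
    by rewrite ltr_pdivrMr ?ltr0n// [ltRHS]mulrC.
  pose r : R := n.+1%:R^-1; have r0 : 0 < r by rewrite invr_gt0 ltr0n.
  have r20 : 0 < r / 2 by rewrite divr_gt0.
  have [m hm] := pext_unif h r20.
  have /choice[q hq] : forall k, exists q : {ffun 'I_d -> rat}, forall i,
      `|pext h (dyad m k) 0 i - ratr (q i)| < r / 2.
    move=> k; have /choice[q hq] : forall i, exists q : rat,
        `|pext h (dyad m k) 0 i - ratr q| < r / 2.
      move=> i; have [|q] := @rat_in_itvoo R (pext h (dyad m k) 0 i - r / 2)
        (pext h (dyad m k) 0 i + r / 2); first lra.
      rewrite in_itv/= => /andP[q1 q2]; exists q.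
      by rewrite ltr_norml; apply/andP; split; lra.
    by exists [ffun i => q i] => i; rewrite ffunE.
  pose c : code := (m, mkseq q (2 ^ m).+1, n).
  have cA : cyl c h.
    move=> l k i; rewrite /c/=; set t := clamp _.
    have t01 : 0 <= t <= 1 by exact: clamp_itv.
    have /andP[t0 t1] := t01.
    rewrite nth_mkseq ?ltnS ?dfloor_le_pow//.
    have -> : pext h (dyad l k) = pext h t.
      by rewrite /pext; congr (h _); apply: val_inj; rewrite !val_ipt (clamp_id t01).
    have h1 : `|pext h t 0 i - pext h (dyad m (dfloor m t)) 0 i| <= r / 2.
      have := enorm_coord (pext h t - pext h (dyad m (dfloor m t))) i; rewrite !mxE.
      move=> /le_trans; apply; apply: hm (leqnn m) _ _ t01 _.
      rewrite ger0_norm ?subr_ge0 ?dfloor_le//.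
      by have := dfloor_gt m t0; lra.
    have h2 := hq (dfloor m t) i.
    rewrite -/r -[X in `|X - _|](subrK (pext h (dyad m (dfloor m t)) 0 i)) -addrA.
    by rewrite (le_trans (ler_normD _ _))//; lra.
  exists c => //; case: asboolP => // -[]; move=> h' h'c; apply: he.
  rewrite ballEmdist /=; apply: le_lt_trans ne.
  apply: sup_dist_le => t; rewrite -!pext_val.
  have /andP[t0 t1] := unit_itvP t.
  have cv : enorm (pext h (dyad l (dfloor l (val t))) - pext h' (dyad l (dfloor l (val t))))
      @[l --> \oo] --> enorm (pext h (val t) - pext h' (val t)).
    apply: enorm_cvg; apply: cvgB;
      apply: (@cvg_comp _ _ _ (fun l => dyad l (dfloor l (val t))));
      (exact: dfloor_cvg || exact: pext_continuous).
  apply: (cvgr_to_le cv); apply: nearW => l; rewrite mulrCA; apply: enorm_le_coord => i.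
  rewrite !mxE; have := cA l (dfloor l (val t)) i; have := h'c l (dfloor l (val t)) i.
  rewrite /c/= -/r; set a := ratr _ => k1 k2.
  rewrite -[X in X - _](subrK a) -addrA -[a - _]opprB (le_trans (ler_normB _ _))//.
  by rewrite mulr_natl mulr2n lerD.
rewrite preimage_bigcup; apply: countable_bigcupT_measurable.
  exact: countableP.
move=> c; case: asboolP => _; first exact: measurable_cyl.
by rewrite preimage_set0.
Qed.

End PathMeasurability.

Section BrownianPath.
Context {R : realType} {d : nat} {disp : measure_display} {Omega : measurableType disp}.
Variables (P : probability Omega R) (W : Omega -> pathE R d).
Hypothesis W_bm : standard_brownian_motion P W.

Lemma measurable_bm_incr l k i :
  measurable_fun [set: Omega] (fun w => incr (pext (W w)) l k 0 i).
Proof.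
rewrite (_ : (fun w => _) = (fun w => pext (W w) (dyad l k.+1) 0 i - pext (W w) (dyad l k) 0 i));
  last by apply/funext => w; rewrite !mxE.
by apply: measurable_funB; exact: (bm_measurable W_bm).
Qed.

Lemma bm_incr_law l k i (B : set R) : (k < 2 ^ l)%N -> measurable B ->
  P ((fun w => incr (pext (W w)) l k 0 i) @^-1` B) = normal_prob 0 (Num.sqrt (2 ^- l)) B.
Proof.
move=> k2 mB.
have v0 : val (ipt (dyad l k)) = dyad l k :> R.
  by rewrite val_ipt clamp_id// dyad_ge0 dyad_le1// ltnW.
have v1 : val (ipt (dyad l k.+1)) = dyad l k.+1 :> R.
  by rewrite val_ipt clamp_id// dyad_ge0 dyad_le1.
have := bm_gaussian W_bm (s := ipt (dyad l k)) (t := ipt (dyad l k.+1)) i.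
have dE : dyad l k.+1 - dyad l k = 2 ^- l :> R by rewrite dyadS addrAC subrr add0r.
rewrite v0 v1 ltr_dyad ltnSn dE => /(_ isT B mB) <-.
by [].
Qed.

(** The tail bound with [K = 2]: half of [1 - K^-2] is [3 / 8], and the squared threshold divided by
    the variance [2^-l] is [b^2 (9 / 16)^l 2^l = b^2 (9 / 8)^l]. *)
Lemma bm_incr_tail l k i (b : R) : (k < 2 ^ l)%N -> 0 <= b ->
  (P [set w | (b * (3 / 4) ^+ l < `|incr (pext (W w)) l k 0 i|)%R] <=
    (2 * expR (- (3 / 8 * b ^+ 2 * (9 / 8) ^+ l)))%:E)%E.
Proof.
move=> k2 b0; set x := b * _; have x0 : 0 <= x by rewrite mulr_ge0// exprn_ge0// divr_ge0.
have mB : measurable [set y : R | x < `|y|].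
  by apply: (@measurable_gt_set _ _ R (fun y : R => `|y|)); exact: normr_measurable.
have -> : [set w | (x < `|incr (pext (W w)) l k 0 i|)%R] =
  (fun w => incr (pext (W w)) l k 0 i) @^-1` [set y : R | x < `|y|] by [].
rewrite bm_incr_law//.
have s0 : 0 < Num.sqrt (2 ^- l) :> R by rewrite sqrtr_gt0 invr_gt0 pow2_gt0.
apply: le_trans (normal_prob_tail s0 (ltr1n _ 2) x0 mB _) _.
  by move=> y /= /ltW.
rewrite lee_fin ler_pM2l// ler_expR lerN2 le_eqVlt; apply/orP; left; apply/eqP.
rewrite sqr_sqrtr ?invr_ge0 ?exprn_ge0// /x [(b * _) ^+ 2]exprMn exprAC.
have -> : (9 / 8 : R) = (3 / 4) ^+ 2 * 2 by lra.
by rewrite exprMn; field; rewrite gt_eqF ?pow2_gt0.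
Qed.

(** A union bound over the [2^l d] coordinates of increments of each level. Since
    [(9 / 8)^l >= 1 + l / 8], the condition [64 <= b ^+ 2] adds at least [2 l] to the exponent, and
    [exp (-2) <= 1 / 4] yields a factor [4^-l] against the [2^l] cells: the levels form a geometric
    series. *)
Lemma bm_holder (b : R) : 0 <= b -> 64 <= b ^+ 2 ->
  exists N : set Omega, [/\ measurable N,
    (P N <= (4 * d%:R * expR (- (3 / 8 * b ^+ 2)))%:E)%E &
    forall w, ~ N w -> holder_set b (W w)].
Proof.
move=> b0 b64.
pose E l (ki : 'I_(2 ^ l) * 'I_d) : set Omega :=
  [set w | b * (3 / 4) ^+ l < `|incr (pext (W w)) l ki.1 0 ki.2|].
pose F l := \big[setU/set0]_(ki : 'I_(2 ^ l) * 'I_d) E l ki.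
have mE l ki : measurable (E l ki).
  apply: measurable_gt_set.
  by apply: measurableT_comp => //; exact: measurable_bm_incr.
have mF l : measurable (F l) by exact: bigsetU_measurable.
exists (\bigcup_l F l); split; first exact: bigcup_measurable.
- apply: le_trans (measure_sigma_subadditive P mF (bigcup_measurable _) (subset_refl _)) _ => //.
  set c := 4 * _ * _.
  have c0 : 0 <= c by rewrite mulr_ge0// expR_ge0.
  apply: le_trans (lee_nneseries (v := fun l => (c / (2 ^ l.+1)%:R)%:E) _ _) _;
    last exact: epsilon_trick0.
    by move=> l _ _; exact: measure_ge0.
  move=> l _; apply: le_trans (measure_big_setU_le _ _ (mE l)) _.
  apply: (@le_trans _ _ (\sum_(ki : 'I_(2 ^ l) * 'I_d)
     (2 * expR (- (3 / 8 * b ^+ 2 * (9 / 8) ^+ l)))%:E)%E).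
    by apply: lee_sum => ki _; apply: bm_incr_tail.
  rewrite sumEFin sumr_const card_prod !card_ord lee_fin.
  have h1 : 1 + l%:R / 8 <= (9 / 8) ^+ l :> R.
    elim: l => [|l IH]; first by rewrite expr0 mul0r addr0.
    rewrite exprS -natr1; have : 0 <= l%:R :> R by []; nra.
  have e4 : expR (- (2 : R)) <= 4^-1.
    rewrite expRN lef_pV2 ?posrE ?expR_gt0//.
    have -> : (2 : R) = 1 + 1 by lra.
    rewrite expRD; have := expR_ge1Dx (1 : R); nra.
  have h2 : expR (- (3 / 8 * b ^+ 2 * (9 / 8) ^+ l)) <=
      expR (- (3 / 8 * b ^+ 2)) * 4 ^- l.
    apply: (@le_trans _ _ (expR (- (3 / 8 * b ^+ 2) + - (2 : R) *+ l))).
      rewrite ler_expR -mulr_natr.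
      have : 0 <= l%:R :> R by [].
      nra.
    have -> : - (2 : R) *+ l = l%:R * - 2 by rewrite mulr_natl.
    rewrite expRD ler_wpM2l ?expR_ge0// expRM_natl -exprVn.
    by rewrite lerXn2r ?nnegrE ?expR_ge0.
  rewrite -[leLHS]mulr_natr natrM natr_pow2 /c exprS.
  apply: le_trans (_ : 2 * (expR (- (3 / 8 * b ^+ 2)) * 4 ^- l) * (2 ^+ l * d%:R) <= _).
    by rewrite ler_wpM2r ?mulr_ge0 ?exprn_ge0// ler_pM2l.
  rewrite le_eqVlt; apply/orP; left; apply/eqP.
  have -> : (4 : R) = 2 * 2 by lra.
  have -> : (2 ^ l.+1)%:R = 2 * 2 ^+ l :> R by rewrite natr_pow2 exprS.
  by rewrite exprMn; field; rewrite gt_eqF ?pow2_gt0.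
move=> w Nw; split; first exact: (bm_start W_bm).
move=> l k i k2; rewrite leNgt; apply/negP => lt; apply: Nw; exists l => //.
by rewrite /F (bigD1 (Ordinal k2, i))//=; left.
Qed.

End BrownianPath.

Lemma prode_le (R : realType) (I : finType) (p : I -> \bar R) (c : I -> R) :
  (forall i, (0 <= p i)%E) -> (forall i, (p i <= (c i)%:E)%E) ->
  (\prod_i p i <= (\prod_i c i)%:E)%E.
Proof.
move=> p0 pc; suff [] : (0 <= \prod_i p i)%E /\ (\prod_i p i <= (\prod_i c i)%:E)%E by [].
elim/big_ind2: _ => [||i _]; [by rewrite lee01|idtac|by split].
by move=> x1 x2 y1 y2 [? ?] [? ?]; rewrite EFinM; split; [exact: mule_ge0|exact: lee_pmul].
Qed.

Lemma prode_ge (R : realType) (I : finType) (p : I -> \bar R) (c : I -> R) :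
  (forall i, 0 <= c i) -> (forall i, ((c i)%:E <= p i)%E) ->
  ((\prod_i c i)%:E <= \prod_i p i)%E.
Proof.
move=> c0 pc; suff [] : 0 <= \prod_i c i /\ ((\prod_i c i)%:E <= \prod_i p i)%E by [].
elim/big_ind2: _ => [||i _]; [by split; rewrite ?ler01|idtac|by split].
move=> x1 x2 y1 y2 [? ?] [? ?]; rewrite EFinM; split; first exact: mulr_ge0.
by apply: lee_pmul; rewrite // lee_fin.
Qed.

(** * Probabilities of boxes of increments *)

Section Boxes.
Context {R : realType} {d : nat} {disp : measure_display} {Omega : measurableType disp}.
Variables (P : probability Omega R) (W : Omega -> pathE R d).
Hypothesis W_bm : standard_brownian_motion P W.

Definition band (eps D rho : R) : set R := [set x | `|Num.sqrt eps * x - D| <= rho].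

(** Unlike a ball around [h], this event constrains finitely many independent variables. *)
Definition incr_box m (eps rho : R) (h : pathE R d) : set Omega :=
  \bigcap_(ki in [set: 'I_(2 ^ m) * 'I_d])
    (fun w => incr (pext (W w)) m ki.1 0 ki.2) @^-1`
      (band eps (incr (pext h) m ki.1 0 ki.2)%R rho).

Let measurable_band (eps D rho : R) :
  measurable (band eps D rho).
Proof.
rewrite -[X in measurable X]setTI; apply: measurable_fun_le => //.
apply: measurableT_comp => //.
by apply: measurable_funB => //; apply: measurable_funM.
Qed.

Lemma measurable_incr_box m eps rho h : measurable (incr_box m eps rho h).
Proof.
apply: fin_bigcap_measurable => // ki _; rewrite -[X in measurable X]setTI.
by apply: (measurable_bm_incr W_bm m ki.1 ki.2 measurableT); exact: measurable_band.
Qed.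

Lemma incr_box_prob m eps rho h : P (incr_box m eps rho h) =
  (\prod_(ki : 'I_(2 ^ m) * 'I_d) normal_prob 0 (Num.sqrt (2 ^- m))
    (band eps (incr (pext h) m ki.1 0 ki.2)%R rho))%E.
Proof.
have := bm_independent W_bm (n := 2 ^ m) (t := fun j => ipt (dyad m j)).
move=> /(_ _)/(_ (fun ki : 'I_(2 ^ m) * 'I_d =>
  (band eps (incr (pext h) m ki.1 0 ki.2)%R rho))) H.
rewrite /incr_box; transitivity (\prod_(ki : 'I_(2 ^ m) * 'I_d)
  P ((fun w => (incr (pext (W w)) m ki.1 0 ki.2)%R) @^-1`
    (band eps (incr (pext h) m ki.1 0 ki.2)%R rho)))%E.
  apply: H => [j k jk|ki]; last exact: measurable_band.
  by rewrite !val_ipt; apply: clamp_mono; rewrite ler_dyad.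
by apply: eq_bigr => ki _; rewrite (bm_incr_law W_bm)//; exact: measurable_band.
Qed.

Let denergyE m (h : pathE R d) : denergy m (pext h) =
  \sum_(ki : 'I_(2 ^ m) * 'I_d) 2 ^+ m * incr (pext h) m ki.1 0 ki.2 ^+ 2.
Proof.
rewrite /denergy -mulr_sumr; congr (_ * _); rewrite big_mkord.
rewrite -(pair_bigA _ (fun (k : 'I_(2 ^ m)) i => incr (pext h) m k 0 i ^+ 2))/=.
by apply: eq_bigr => k _; rewrite enorm_sq.
Qed.

Lemma incr_box_upper m (h : pathE R d) (alpha : R) :
  alpha < denergy m (pext h) / 2 -> exists rho C : R, [/\ 0 < rho, 0 <= C &
    forall eps, 0 < eps -> (P (incr_box m eps rho h) <= (C * expR (- (alpha / eps)))%:E)%E].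
Proof.
set E := denergy m _ => aE.
have [a0|a0] := leP alpha 0.
  exists 1, 1; split=> // eps eps0; rewrite mul1r.
  apply: (@le_trans _ _ 1%E); first by apply: probability_le1; exact: measurable_incr_box.
  by rewrite lee_fin -[leLHS]expR0 ler_expR oppr_ge0 pmulr_lle0// invr_gt0.
pose D (ki : 'I_(2 ^ m) * 'I_d) := incr (pext h) m ki.1 0 ki.2.
pose S := \sum_ki 2 ^+ m * `|D ki|.
have S0 : 0 <= S by apply: sumr_ge0 => ki _; rewrite mulr_ge0// exprn_ge0.
(* The gap is shared: one half covers the loss [2 rho S] due to the width of the box, the other half
   the loss [K^-2 E] due to the tail bound. *)
have gap : 0 < E - 2 * alpha by lra.
pose rho := (E - 2 * alpha) / (4 * (S + 1)).
have rho0 : 0 < rho by rewrite divr_gt0// mulr_gt0//; lra.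
have rhoS : 2 * rho * S <= (E - 2 * alpha) / 2.
  have -> : 2 * rho * S = (E - 2 * alpha) / 2 * (S / (S + 1)).
    by rewrite /rho; field; apply/eqP; lra.
  rewrite ler_piMr ?divr_ge0 ?(ltW gap)//.
  by rewrite ler_pdivrMr ?mul1r; lra.
pose K := 1 + 2 * E / (E - 2 * alpha).
have K1 : 1 < K by rewrite ltrDl divr_gt0//; lra.
have KE : (1 - K ^- 2) * E >= (E + 2 * alpha) / 2.
  have KK : K ^- 2 <= (E - 2 * alpha) / (2 * E).
    rewrite -[leRHS]invrK lef_pV2 ?posrE ?exprn_gt0 ?invr_gt0 ?divr_gt0//; try lra.
    rewrite invf_div; apply: (@le_trans _ _ K); first by rewrite lerDr.
    by rewrite expr2 ler_peMl ?ltW//; lra.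
  have E0 : 0 < E by lra.
  have : K ^- 2 * E <= (E - 2 * alpha) / (2 * E) * E by rewrite ler_pM2r.
  have -> : (E - 2 * alpha) / (2 * E) * E = (E - 2 * alpha) / 2.
    by field; rewrite gt_eqF.
  lra.
have KK0 : 0 <= 1 - K ^- 2 <= 1.
  have : 0 < K ^- 2 by rewrite invr_gt0 exprn_gt0//; lra.
  have : K ^- 2 <= 1 by rewrite invf_le1 ?exprn_gt0 ?exprn_ege1 ?ltW//; lra.
  by move=> ? ?; apply/andP; split; lra.
exists rho, (K ^+ #|{: 'I_(2 ^ m) * 'I_d}|); split => // [|eps eps0].
  by rewrite exprn_ge0//; lra.
rewrite incr_box_prob.
pose c ki := K * expR (- ((1 - K ^- 2) * (2 ^+ m * (D ki ^+ 2 - 2 * rho * `|D ki|)) / (2 * eps))).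
have s0 : 0 < Num.sqrt (2 ^- m) :> R by rewrite sqrtr_gt0 invr_gt0 pow2_gt0.
have se0 : 0 < Num.sqrt eps by rewrite sqrtr_gt0.
apply: le_trans (prode_le (c := c) _ _) _ => [ki|ki|].
- exact: measure_ge0.
(* On the band the variable is at least [x] in absolute value; the maximum with [0] is for
   increments smaller than [rho]. *)
- pose x := Num.max 0 (`|D ki| - rho) / Num.sqrt eps.
  have x0 : 0 <= x by rewrite divr_ge0 ?(ltW se0)// le_max lexx.
  apply: le_trans (normal_prob_tail s0 K1 x0 (measurable_band _ _ _) _) _.
    move=> y; rewrite /band/= => yD.
    rewrite ler_pdivrMr// mulrC -{1}(gtr0_norm se0) -normrM ge_max normr_ge0/=.
    have := ler_normB (Num.sqrt eps * y) (Num.sqrt eps * y - D ki).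
    by rewrite opprB addrC subrK; move: yD; rewrite -/(D ki); lra.
  rewrite lee_fin ler_pM2l; last lra.
  rewrite ler_expR lerN2 sqr_sqrtr ?invr_ge0 ?exprn_ge0//.
  have x2 : (D ki ^+ 2 - 2 * rho * `|D ki|) / eps <= x ^+ 2.
    rewrite /x expr_div_n sqr_sqrtr ?(ltW eps0)// ler_pM2r ?invr_gt0//.
    rewrite -[D ki ^+ 2]real_normK ?num_real//.
    have := normr_ge0 (D ki); set v := `|D ki| => v0.
    by case: (leP 0 (v - rho)) => ?; nra.
  have /andP[k0 _] := KK0; have p0 := @pow2_gt0 R m.
  have -> : (1 - K ^- 2) * (2 ^+ m * (D ki ^+ 2 - 2 * rho * `|D ki|)) / (2 * eps) =
    (1 - K ^- 2) * (2 ^+ m / 2 * ((D ki ^+ 2 - 2 * rho * `|D ki|) / eps)).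
    by field; rewrite !gt_eqF// (lt_trans ltr01).
  have -> : (1 - K ^- 2) * x ^+ 2 / (2 * 2 ^- m) = (1 - K ^- 2) * (2 ^+ m / 2 * x ^+ 2).
    by field; rewrite !gt_eqF// (lt_trans ltr01).
  by rewrite ler_wpM2l// ler_pM2l// divr_gt0.
rewrite lee_fin /c big_split/= prodr_const -expR_sum ler_wpM2l ?exprn_ge0//; first lra.
rewrite ler_expR sumrN lerN2 -mulr_suml -mulr_sumr.
have -> : \sum_ki 2 ^+ m * (D ki ^+ 2 - 2 * rho * `|D ki|) = E - 2 * rho * S.
  rewrite /E denergyE /S mulr_sumr -sumrB; apply: eq_bigr => ki _.
  by rewrite mulrBr; congr (_ - _); ring.
have -> : (1 - K ^- 2) * (E - 2 * rho * S) / (2 * eps) = (1 - K ^- 2) * (E - 2 * rho * S) / 2 / eps.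
  by field; rewrite !gt_eqF// (lt_trans ltr01).
rewrite ler_pM2r ?invr_gt0// ler_pdivlMr//.
have /andP[k0 k1] := KK0.
have : (1 - K ^- 2) * (2 * rho * S) <= 2 * rho * S.
  by rewrite ler_piMl// mulr_ge0// mulr_ge0// ltW.
lra.
Qed.

Lemma incr_box_lower m (h : pathE R d) (eta rho0 : R) : 0 < eta -> 0 < rho0 ->
  exists rho c : R, [/\ 0 < rho, rho <= rho0, 0 < c &
    forall eps, 0 < eps -> eps <= 1 ->
    ((c * expR (- ((denergy m (pext h) / 2 + eta) / eps)))%:E <= P (incr_box m eps rho h))%E].
Proof.
move=> eta0 rho00; set E := denergy m _.
pose D (ki : 'I_(2 ^ m) * 'I_d) := incr (pext h) m ki.1 0 ki.2.
(* For [rho <= 1] one has [(|D| + rho)^2 <= D^2 + rho (2 |D| + 1)], so that [rho S] bounds what the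
   width of the box adds to the energy. *)
pose S := \sum_ki 2 ^+ m * (2 * `|D ki| + 1).
have S0 : 0 <= S.
  by apply: sumr_ge0 => ki _; rewrite mulr_ge0 ?exprn_ge0// addr_ge0// mulr_ge0.
pose rho := Num.min (Num.min rho0 1) (eta / (S + 1)).
have rho_gt0 : 0 < rho by rewrite !lt_min rho00 ltr01 divr_gt0//; lra.
have rho1 : rho <= 1 by rewrite !ge_min lexx orbT.
have rhoS : rho * S <= 2 * eta.
  have : rho <= eta / (S + 1) by rewrite ge_min lexx orbT.
  rewrite ler_pdivlMr; last lra.
  nra.
have s0 : 0 < Num.sqrt (2 ^- m) :> R by rewrite sqrtr_gt0 invr_gt0 pow2_gt0.
pose c0 := 2 * rho * normal_peak (Num.sqrt (2 ^- m)).
have c00 : 0 < c0 by rewrite mulr_gt0 ?normal_peak_gt0 ?gt_eqF// mulr_gt0.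
exists rho, (c0 ^+ #|{: 'I_(2 ^ m) * 'I_d}|); split => [//|||eps eps0 eps1].
- by rewrite !ge_min lexx.
- by rewrite exprn_gt0.
rewrite incr_box_prob.
have se0 : 0 < Num.sqrt eps by rewrite sqrtr_gt0.
have se1 : Num.sqrt eps <= 1 by rewrite -sqrtr1 ler_wsqrtr.
pose c ki := c0 * expR (- (2 ^+ m * (`|D ki| + rho) ^+ 2 / (2 * eps))).
apply: le_trans (prode_ge (c := c) _ _) => [|ki|ki].
- rewrite lee_fin /c big_split/= prodr_const -expR_sum ler_pM2l ?exprn_gt0//.
  rewrite ler_expR sumrN lerN2 -mulr_suml.
  have le : \sum_ki 2 ^+ m * (`|D ki| + rho) ^+ 2 <= E + rho * S.
    rewrite /E denergyE /S mulr_sumr -big_split/=; apply: ler_sum => ki _.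
    rewrite [rho * _]mulrCA -mulrDr ler_pM2l ?pow2_gt0//.
    rewrite -[X in _ <= X + _]real_normK ?num_real// -/(D ki).
    by have := normr_ge0 (D ki); nra.
  set X := (X in X <= _) in le *.
  have -> : X / (2 * eps) = X / 2 / eps by field; rewrite !gt_eqF.
  by rewrite ler_pM2r ?invr_gt0// ler_pdivrMr//; lra.
- by rewrite mulr_ge0 ?expR_ge0// ltW.
have -> : (band eps (incr (pext h) m ki.1 0 ki.2)%R rho) =
    `[(D ki / Num.sqrt eps - rho / Num.sqrt eps)%R,
      (D ki / Num.sqrt eps + rho / Num.sqrt eps)%R]%classic.
  rewrite /band; apply/seteqP; split => x /=;
    rewrite in_itv/= -/(D ki) -mulrBl -mulrDl ler_pdivrMr// ler_pdivlMr//.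
    by rewrite mulrC ler_norml => /andP[? ?]; apply/andP; split; lra.
  by rewrite mulrC ler_norml => /andP[? ?]; apply/andP; split; lra.
apply: le_trans (normal_prob_itv_ge _ s0 _); last by rewrite divr_gt0.
rewrite lee_fin /c /c0.
have p0 := @pow2_gt0 R m.
have -> : (`|D ki / Num.sqrt eps| + rho / Num.sqrt eps) ^+ 2 / (2 * Num.sqrt (2 ^- m) ^+ 2) =
    2 ^+ m * (`|D ki| + rho) ^+ 2 / (2 * eps).
  rewrite normrM normfV (gtr0_norm se0) -mulrDl expr_div_n !sqr_sqrtr ?(ltW eps0)//.
  by field; rewrite !gt_eqF.
(* [eps <= 1] keeps the length [2 rho / sqrt eps] of the interval above [2 rho], which makes the
   constant uniform in [eps]. *)
rewrite ler_wpM2r ?expR_ge0// ler_wpM2r ?normal_peak_ge0// ler_pM2l//.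
by rewrite ler_pdivlMr// ler_piMr// ltW.
Qed.

End Boxes.

(** * The bridge map *)

Section AffineMaps.
Context {R : realType} {d : nat}.
Implicit Types (u h p : pathE R d) (z : 'rV[R]_d * 'rV[R]_d).

(** The summand with [0] gives this the shape that [affine_continuous] covers. *)
Definition affine_fun (c : R) (x y : 'rV[R]_d) u (t : unit_itv R) : 'rV[R]_d :=
  c *: (u t - val t *: 0) + ((1 - val t) *: x + val t *: y).

Lemma affine_fun_continuous c x y u : continuous (affine_fun c x y u).
Proof.
by apply: affine_continuous; [exact: initial_continuous|exact: path_continuous].
Qed.

Definition affine_path c x y u : pathE R d :=
  (mkcts (@affine_fun_continuous c x y u) : continuousType _ _).

Lemma affine_pathE c x y u t :
  affine_path c x y u t = c *: u t + ((1 - val t) *: x + val t *: y).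
Proof. by rewrite -[LHS]/(affine_fun c x y u t) /affine_fun scaler0 subr0. Qed.

Definition scale_path c u := affine_path c 0 0 u.

Lemma scale_pathE c u t : scale_path c u t = c *: u t.
Proof. by rewrite affine_pathE !scaler0 !addr0. Qed.

Lemma noisy_bridgeE eps z u t : noisy_bridge eps z u t =
  Num.sqrt eps *: (u t - val t *: u I1) + ((1 - val t) *: z.1 + val t *: z.2).
Proof. by []. Qed.

(** The noise level is moved into the path, so that one map serves every [eps]. *)
Definition bridge_map z u := noisy_bridge 1 z u.

Lemma bridge_mapE z u t : bridge_map z u t =
  (u t - val t *: u I1) + ((1 - val t) *: z.1 + val t *: z.2).
Proof. by rewrite noisy_bridgeE sqrtr1 scale1r. Qed.

Lemma noisy_bridge_scale eps z u :
  noisy_bridge eps z u = bridge_map z (scale_path (Num.sqrt eps) u).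
Proof.
apply/continuousEP => t; rewrite -[LHS]/(noisy_bridge eps z u t).
rewrite -[RHS]/(bridge_map z (scale_path (Num.sqrt eps) u) t).
rewrite noisy_bridgeE bridge_mapE !scale_pathE scalerBr; congr (_ - _ + _).
by rewrite !scalerA mulrC.
Qed.

Lemma val_I0 : val (I0 : unit_itv R) = 0. Proof. by []. Qed.
Lemma val_I1 : val (I1 : unit_itv R) = 1. Proof. by []. Qed.

Lemma bridge_map0 z u : u I0 = 0 -> bridge_map z u I0 = z.1.
Proof.
by move=> u0; rewrite bridge_mapE u0 val_I0; apply/rowP => i; rewrite !mxE; ring.
Qed.

Lemma bridge_map1 z u : bridge_map z u I1 = z.2.
Proof. by rewrite bridge_mapE val_I1; apply/rowP => i; rewrite !mxE; ring. Qed.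

Lemma enormZ c (x : 'rV[R]_d) : enorm (c *: x) = `|c| * enorm x.
Proof.
rewrite /enorm -sqrtr_sqr -sqrtrM ?sqr_ge0// mulr_sumr.
by congr Num.sqrt; apply: eq_bigr => i _; rewrite mxE exprMn.
Qed.

Lemma enormZ_itv (t : unit_itv R) (x : 'rV[R]_d) : enorm (val t *: x) <= enorm x.
Proof.
by have /andP[t0 t1] := unit_itvP t; rewrite enormZ ger0_norm// ler_piMl// enorm_ge0.
Qed.

(** The factor [2] counts the displacements at time [t] and at time [1]. *)
Lemma bridge_map_lip z z' u p : sup_dist (bridge_map z' u) (bridge_map z p) <=
  2 * sup_dist u p + (enorm (z'.1 - z.1) + enorm (z'.2 - z.2)).
Proof.
apply: sup_dist_le => t; rewrite !bridge_mapE.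
have -> : u t - val t *: u I1 + ((1 - val t) *: z'.1 + val t *: z'.2) -
    (p t - val t *: p I1 + ((1 - val t) *: z.1 + val t *: z.2)) =
    (u t - p t) + - (val t *: (u I1 - p I1)) +
    ((1 - val t) *: (z'.1 - z.1) + val t *: (z'.2 - z.2)).
  by apply/rowP => i; rewrite !mxE; ring.
have /andP[t0 t1] := unit_itvP t.
apply: le_trans (enormD _ _) _; apply: lerD.
  apply: le_trans (enormD _ _) _; rewrite enormN mulr_natl mulr2n.
  by apply: lerD; [exact: sup_dist_ub|exact: le_trans (enormZ_itv _ _) (sup_dist_ub _ _ _)].
apply: le_trans (enormD _ _) _; apply: lerD; last exact: enormZ_itv.
rewrite enormZ ger0_norm ?subr_ge0// ler_piMl ?enorm_ge0//; lra.
Qed.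

(** Each side is a sum over coordinates of [2^m sum x_k^2 - (sum x_k)^2], which is [4^m] times the
    variance of the increments [x_k] and does not change when all of them are shifted by the same
    amount. *)
Lemma denergy_affine m u p (x v : 'rV[R]_d) : (forall t, p t = u t + (x + val t *: v)) ->
  denergy m (pext p) - enorm (p I1 - p I0) ^+ 2 =
  denergy m (pext u) - enorm (u I1 - u I0) ^+ 2.
Proof.
move=> pE; have p2 := @pow2_gt0 R m.
have E h : denergy m (pext h) - enorm (h I1 - h I0) ^+ 2 =
    \sum_i (2 ^+ m * (\sum_(0 <= k < 2 ^ m) incr (pext h) m k 0 i ^+ 2) -
      (\sum_(0 <= k < 2 ^ m) incr (pext h) m k 0 i) ^+ 2).
  rewrite sumrB -mulr_sumr exchange_big/= /denergy; congr (_ * _ - _).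
    by apply: eq_bigr => k _; rewrite enorm_sq.
  rewrite enorm_sq; apply: eq_bigr => i _; rewrite -summxE sum_incr//.
  by rewrite dyad_full dyad0 /pext ipt0 ipt1.
rewrite !E; apply: eq_bigr => i _.
have pincr k : (k < 2 ^ m)%N -> incr (pext p) m k 0 i = incr (pext u) m k 0 i + 2 ^- m * v 0 i.
  move=> k2; rewrite !mxE /pext !pE !mxE !val_ipt !clamp_id.
  - by rewrite dyadS; ring.
  - by rewrite dyad_ge0 dyad_le1// ltnW.
  - by rewrite dyad_ge0 dyad_le1.
set s1 := \sum_(0 <= k < 2 ^ m) incr (pext u) m k 0 i.
set s2 := \sum_(0 <= k < 2 ^ m) incr (pext u) m k 0 i ^+ 2.
have -> : \sum_(0 <= k < 2 ^ m) incr (pext p) m k 0 i = s1 + v 0 i.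
  transitivity (\sum_(0 <= k < 2 ^ m) (incr (pext u) m k 0 i + 2 ^- m * v 0 i)).
    by apply: eq_big_nat => k /andP[_ k2]; exact: pincr.
  rewrite big_split/= sumr_const_nat subn0 -/s1 -[_ *+ (2 ^ m)]mulr_natl natr_pow2.
  by field; rewrite gt_eqF.
have -> : \sum_(0 <= k < 2 ^ m) incr (pext p) m k 0 i ^+ 2 =
    s2 + 2 * (2 ^- m * v 0 i) * s1 + 2 ^- m * v 0 i ^+ 2.
  transitivity (\sum_(0 <= k < 2 ^ m) (incr (pext u) m k 0 i ^+ 2 +
      2 * (2 ^- m * v 0 i) * incr (pext u) m k 0 i + (2 ^- m * v 0 i) ^+ 2)).
    by apply: eq_big_nat => k /andP[_ k2]; rewrite pincr//; ring.
  rewrite !big_split/= sumr_const_nat subn0 -mulr_sumr -/s1 -/s2.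
  by rewrite -[_ *+ (2 ^ m)]mulr_natl natr_pow2; field; rewrite gt_eqF.
by field; rewrite gt_eqF.
Qed.

Lemma bridge_map_denergy m z u : u I0 = 0 ->
  denergy m (pext (bridge_map z u)) - enorm (z.1 - z.2) ^+ 2 <= denergy m (pext u).
Proof.
move=> u0; have e0 := bridge_map0 z u0; have e1 := bridge_map1 z u.
have := @denergy_affine m u (bridge_map z u) z.1 (z.2 - z.1 - u I1).
rewrite e0 e1 -[z.1 - z.2]opprB enormN => -> => [|t].
  by rewrite gerBl sqr_ge0.
by rewrite bridge_mapE; apply/rowP => i; rewrite !mxE; ring.
Qed.

(** Subtracting the segment from [h] gives the preimage of [h] that vanishes at time [1], for which
    the inequality of [bridge_map_denergy] is an equality. *)
Lemma centered_denergy m z h : (h I0, h I1) = z ->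
  denergy m (pext (affine_path 1 (- z.1) (- z.2) h)) =
  denergy m (pext h) - enorm (z.1 - z.2) ^+ 2.
Proof.
move=> hz; have [e0 e1] : h I0 = z.1 /\ h I1 = z.2 by rewrite -hz.
set g := affine_path _ _ _ _.
have g0 : g I0 = 0.
  by rewrite affine_pathE val_I0 e0 scale1r subr0 scale1r scale0r addr0 subrr.
have g1 : g I1 = 0.
  by rewrite affine_pathE val_I1 e1 !scale1r subrr scale0r add0r subrr.
have := @denergy_affine m h g (- z.1) (z.1 - z.2).
rewrite g0 g1 e0 e1 -[z.2 - z.1]opprB enormN subr0 enorm0 expr0n subr0 => -> // t.
by rewrite affine_pathE; apply/rowP => i; rewrite !mxE; ring.
Qed.

Lemma bridge_map_centered z h : (h I0, h I1) = z ->
  bridge_map z (affine_path 1 (- z.1) (- z.2) h) = h.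
Proof.
move=> hz; have [e0 e1] : h I0 = z.1 /\ h I1 = z.2 by rewrite -hz.
apply/continuousEP => t; rewrite -[LHS]/(bridge_map z (affine_path 1 (- z.1) (- z.2) h) t).
rewrite bridge_mapE !affine_pathE val_I1 e1 -[RHS]/(h t).
by apply/rowP => i; rewrite !mxE; ring.
Qed.

Lemma energy_ge0 h : (0 <= energy h)%E.
Proof. by apply: integral_ge0 => t _; rewrite lee_fin sqr_ge0. Qed.

Lemma rate_in_H z h : in_H h -> (h I0, h I1) = z ->
  rate z h = ((fine (energy h) - enorm (z.1 - z.2) ^+ 2) / 2)%:E.
Proof.
move=> hH hz; have [e E] : exists e, energy h = e%:E.
  have [_ hfin] := hH; exists (fine (energy h)).
  by rewrite fineK// ge0_fin_numE ?energy_ge0.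
rewrite /rate /H_norm asboolT// /iota_set mem_set// adde0 sqr_sqrte ?energy_ge0//.
by rewrite E -EFinM -EFinB/=; congr EFin; lra.
Qed.

Lemma rate_lty z h : (rate z h < +oo)%E -> in_H h /\ (h I0, h I1) = z.
Proof.
have [hH|nH] := pselect (in_H h); last first.
  rewrite /rate /H_norm asboolF// expe2 mulyy gt0_mulye ?lte_fin ?invr_gt0//.
  by rewrite /iota_set; case: ifP => _; rewrite ?adde0 ?addey// addye.
have [hz|nz] := pselect ((h I0, h I1) = z); first by [].
rewrite /rate /iota_set memNset// addey//.
rewrite /H_norm asboolT// sqr_sqrte ?energy_ge0//.
have := energy_ge0 h; case: (energy h) => [e _ //|_|//].
by rewrite gt0_mulye ?lte_fin ?invr_gt0.
Qed.

End AffineMaps.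

(** * Large deviations *)

Section Scale.
Context {R : realType}.
Implicit Types (e C alpha beta : R) (p : \bar R).

Lemma eps_lne_le e alpha p : 0 < e -> (0 <= p)%E -> (p <= (expR (- (alpha / e)))%:E)%E ->
  (e%:E * lne p <= (- alpha)%:E)%E.
Proof.
move=> e0 p0 pa; have : (lne p <= (- (alpha / e))%:E)%E.
  rewrite -[X in (_ <= X%:E)%E]expRK -lne_EFin ?expR_gt0//.
  by rewrite lee_lne// in_itv/= ?p0 ?leey// lee_fin expR_ge0.
have e0' : (0 <= e%:E)%E by rewrite lee_fin ltW.
move=> h; apply: le_trans (lee_wpmul2l e0' h) _.
by rewrite -EFinM lee_fin mulrN mulrCA divff ?mulr1// gt_eqF.
Qed.

Lemma eps_lne_ge e alpha p : 0 < e -> ((expR (- (alpha / e)))%:E <= p)%E ->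
  ((- alpha)%:E <= e%:E * lne p)%E.
Proof.
move=> e0 pa; have p0 : (0 <= p)%E by apply: le_trans pa; rewrite lee_fin expR_ge0.
have : ((- (alpha / e))%:E <= lne p)%E.
  rewrite -[X in (X%:E <= _)%E]expRK -lne_EFin ?expR_gt0//.
  by rewrite lee_lne// in_itv/= ?p0 ?leey// lee_fin expR_ge0.
have e0' : (0 <= e%:E)%E by rewrite lee_fin ltW.
move=> h; apply: le_trans (lee_wpmul2l e0' h).
by rewrite -EFinM lee_fin mulrN mulrCA divff ?mulr1// gt_eqF.
Qed.

(** Constants do not count on the exponential scale: [expR x >= x] gives
    [C <= expR ((alpha - beta) / eps)] as soon as [eps <= (alpha - beta) / C]. *)
Lemma near_expR_absorb (eps : nat -> R) C alpha beta :
  (forall k, 0 < eps k) -> eps k @[k --> \oo] --> 0 -> beta < alpha ->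
  \forall k \near \oo, C * expR (- (alpha / eps k)) <= expR (- (beta / eps k)).
Proof.
move=> eps0 epsc ba; have [C0|C0] := leP C 0.
  by apply: nearW => k; apply: (@le_trans _ _ 0); rewrite ?expR_ge0// mulr_le0_ge0 ?expR_ge0.
have g0 : 0 < (alpha - beta) / C by rewrite divr_gt0// subr_gt0.
move/cvgrPdist_lt: epsc => /(_ _ g0); apply: filterS => k.
rewrite sub0r normrN gtr0_norm// => h.
have -> : - (beta / eps k) = (alpha - beta) / eps k + - (alpha / eps k).
  by field; rewrite gt_eqF.
rewrite expRD ler_pM2r ?expR_gt0//.
apply: le_trans (expR_ge1Dx _); apply: (@le_trans _ _ ((alpha - beta) / eps k)); last lra.
by rewrite ler_pdivlMr// mulrC -ler_pdivlMr// ltW.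
Qed.

End Scale.

Lemma ball_pathE {R : realType} {d : nat} (p q : pathE R d) (r : R) :
  ball p r q = (sup_dist p q < r) :> Prop.
Proof. by rewrite ballEmdist. Qed.

(** One [r] for each path between [t] and its floor, and one for the values at the floor, where the
    errors of at most [2^m] increments accumulate. *)
Lemma sup_dist_grid {R : realType} {d : nat} (u g : pathE R d) m (rho r : R) :
  u I0 = g I0 -> d%:R * (2 ^+ m * rho) <= r ->
  (forall k i, (k < 2 ^ m)%N -> `|(incr (pext u) m k - incr (pext g) m k) 0 i| <= rho) ->
  (forall s t : R, 0 <= s <= 1 -> 0 <= t <= 1 -> `|s - t| <= 2 ^- m ->
    enorm (pext u s - pext u t) <= r /\ enorm (pext g s - pext g t) <= r) ->
  sup_dist u g <= 3 * r.
Proof.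
move=> ug0 rhor uincr modulus.
have coord j i : (j <= 2 ^ m)%N ->
    `|(pext u (dyad m j) - pext g (dyad m j)) 0 i| <= j%:R * rho.
  elim: j => [|j IH] j2; first by rewrite dyad0 /pext ipt0 ug0 subrr mxE normr0 mul0r.
  rewrite -natr1 mulrDl mul1r.
  have -> : pext u (dyad m j.+1) - pext g (dyad m j.+1) =
      (pext u (dyad m j) - pext g (dyad m j)) + (incr (pext u) m j - incr (pext g) m j).
    by rewrite /incr; apply/rowP => l; rewrite !mxE; ring.
  by rewrite mxE (le_trans (ler_normD _ _))// lerD// ?IH ?uincr// ltnW.
apply: sup_dist_le => t; have t01 := unit_itvP t; have /andP[t0 t1] := t01.
set k := dfloor m (val t); have k2 : (k <= 2 ^ m)%N by exact: dfloor_le_pow.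
have s01 : 0 <= (dyad m k : R) <= 1 by rewrite dyad_ge0 dyad_le1.
have ts : `|val t - dyad m k| <= 2 ^- m.
  by rewrite ger0_norm ?subr_ge0 ?dfloor_le//; have /andP[_] := dfloor_itv m t0; rewrite dyadS; lra.
have [hu hg] := modulus _ _ t01 s01 ts.
have hk : enorm (pext u (dyad m k) - pext g (dyad m k)) <= r.
  apply: le_trans (enorm_le_coord _) rhor => i; apply: le_trans (coord k i k2) _.
  have rho0 : 0 <= rho by apply: le_trans (normr_ge0 _) (uincr 0%N i _); rewrite expn_gt0.
  by rewrite ler_wpM2r// -natr_pow2 ler_nat.
rewrite -!pext_val -[pext u (val t) - pext g (val t)](subrKA (pext u (dyad m k))).
rewrite (le_trans (enormD _ _))// -[pext u (dyad m k) - pext g (val t)](subrKA (pext g (dyad m k))).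
have := enormD (pext u (dyad m k) - pext g (dyad m k)) (pext g (dyad m k) - pext g (val t)).
by rewrite -[pext g (dyad m k) - pext g (val t)]opprB enormN; lra.
Qed.

(** * Lower and upper bounds for the laws of the bridges *)

Section Schilder.
Context {R : realType} {d : nat} {disp : measure_display} {Omega : measurableType disp}.
Variables (P : probability Omega R) (W : Omega -> pathE R d).
Hypothesis W_bm : standard_brownian_motion P W.
Implicit Types (u h p : pathE R d) (z : 'rV[R]_d * 'rV[R]_d).

Let sW (eps : R) w : pathE R d := scale_path (Num.sqrt eps) (W w).

Let incr_sW eps w m k i :
  incr (pext (sW eps w)) m k 0 i = Num.sqrt eps * incr (pext (W w)) m k 0 i.
Proof. by rewrite /incr /sW /pext !scale_pathE !mxE mulrBr. Qed.

Lemma scaled_holder (eps a : R) w : 0 < eps -> holder_set (a / Num.sqrt eps) (W w) ->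
  holder_set a (scale_path (Num.sqrt eps) (W w)).
Proof.
move=> e0 [w0 wh]; have se0 : 0 < Num.sqrt eps by rewrite sqrtr_gt0.
split; first by rewrite scale_pathE w0 scaler0.
move=> l k i k2; rewrite incr_sW normrM gtr0_norm//.
have := wh l k i k2; rewrite -(ler_pM2l se0) mulrA => /le_trans; apply.
by rewrite mulrCA divff ?mulr1// gt_eqF.
Qed.

Lemma scaled_holder_prob (eps a : R) : 0 < eps -> eps <= 1 -> 8 <= a ->
  exists N : set Omega, [/\ measurable N,
    (P N <= (4 * d%:R * expR (- (3 / 8 * a ^+ 2 / eps)))%:E)%E &
    forall w, ~ N w -> holder_set a (scale_path (Num.sqrt eps) (W w))].
Proof.
move=> e0 e1 a8; have se0 : 0 < Num.sqrt eps by rewrite sqrtr_gt0.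
have b2 : (a / Num.sqrt eps) ^+ 2 = a ^+ 2 / eps by rewrite expr_div_n sqr_sqrtr// ltW.
have [||N [mN PN Nh]] := bm_holder W_bm (b := a / Num.sqrt eps).
- by rewrite divr_ge0 ?(ltW se0)//; lra.
- by rewrite b2 ler_pdivlMr//; nra.
exists N; split=> //; first by rewrite b2 mulrA in PN.
by move=> w /Nh; exact: scaled_holder.
Qed.

Lemma measurable_noisy_bridge eps z (A : set (pathE R d)) : open A ->
  measurable [set w | A (noisy_bridge eps z (W w))].
Proof.
apply: (@measurable_path_preimage _ _ _ _ (fun w => noisy_bridge eps z (W w))) => t i.
rewrite (_ : (fun w => _) = (fun w => Num.sqrt eps * (W w t 0 i - val t * W w I1 0 i) +
    ((1 - val t) * z.1 0 i + val t * z.2 0 i))); last first.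
  by apply/funext => w; rewrite noisy_bridgeE !mxE.
apply: measurable_funD => //; apply: measurable_funM => //.
apply: measurable_funB; first exact: (bm_measurable W_bm).
by apply: measurable_funM => //; exact: (bm_measurable W_bm).
Qed.

Lemma bridge_lawE eps z A :
  bridge_law P W eps z A = P [set w | A (noisy_bridge eps z (W w))].
Proof. by []. Qed.

Variable eps : nat -> R.
Hypotheses (eps_gt0 : forall k, 0 < eps k) (eps_cvg0 : eps k @[k --> \oo] --> 0).

Let eps_le1 : \forall k \near \oo, eps k <= 1.
Proof.
move/cvgrPdist_lt: eps_cvg0 => /(_ 1 ltr01); apply: filterS => k.
by rewrite sub0r normrN gtr0_norm// => /ltW.
Qed.

Let ends_err (z_ : nat -> 'rV[R]_d * 'rV[R]_d) z (e : R) : z_ k @[k --> \oo] --> z -> 0 < e ->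
  \forall k \near \oo, enorm ((z_ k).1 - z.1) + enorm ((z_ k).2 - z.2) < e.
Proof.
move=> zc e0.
have c1 : enorm ((z_ k).1 - z.1) @[k --> \oo] --> (0 : R).
  rewrite -[X in _ --> X](@enorm0 R d) -(subrr z.1); apply: enorm_cvg.
  apply: cvgB; last exact: cvg_cst.
  exact: (cvg_comp _ _ zc cvg_fst).
have c2 : enorm ((z_ k).2 - z.2) @[k --> \oo] --> (0 : R).
  rewrite -[X in _ --> X](@enorm0 R d) -(subrr z.2); apply: enorm_cvg.
  apply: cvgB; last exact: cvg_cst.
  exact: (cvg_comp _ _ zc cvg_snd).
have : enorm ((z_ k).1 - z.1) + enorm ((z_ k).2 - z.2) @[k --> \oo] --> (0 : R).
  by rewrite -[X in _ --> X]addr0; exact: cvgD.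
move/cvgrPdist_lt => /(_ e e0); apply: filterS => k.
by rewrite sub0r normrN; apply: le_lt_trans; exact: ler_norm.
Qed.

Lemma bridge_law_lower (A : set (pathE R d))
    (z_ : nat -> 'rV[R]_d * 'rV[R]_d) z h (eta : R) :
  open A -> z_ k @[k --> \oo] --> z -> A h -> in_H h -> (h I0, h I1) = z -> 0 < eta ->
  \forall k \near \oo,
   ((expR (- (((fine (energy h) - enorm (z.1 - z.2) ^+ 2) / 2 + eta) / eps k)))%:E <=
    bridge_law P W (eps k) (z_ k) A)%E.
Proof.
move=> oA zc Ah hH hz eta0; set J := (_ / 2).
have /nbhs_ballP[r0 /= r00 hr] : nbhs h A by apply: open_nbhs_nbhs.
(* The bridge map doubles the distance [3 r1] and the end points add less than [r1], in all less
   than [r0]. *)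
pose r1 := r0 / 8; have r10 : 0 < r1 by rewrite divr_gt0.
pose g := affine_path 1 (- z.1) (- z.2) h.
have gh : bridge_map z g = h by exact: bridge_map_centered.
have E : energy h = (fine (energy h))%:E.
  by rewrite fineK// ge0_fin_numE ?energy_ge0//; have [] := hH.
have gE m : denergy m (pext g) / 2 <= J.
  rewrite (centered_denergy m hz) ler_pM2r// lerD2r.
  by have := in_H_denergy m hH; rewrite E lee_fin.
(* This makes the exponent [3 a^2 / 8] of the exceptional event at least [J + eta]. *)
pose a := 8 * (1 + `|J + eta|).
have a8 : 8 <= a by rewrite /a; have := normr_ge0 (J + eta); lra.
have aJ : J + eta <= 3 / 8 * a ^+ 2.
  have := ler_norm (J + eta); have := normr_ge0 (J + eta); rewrite /a.
  by move: `|_| => v; nra.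
have [m1 hm1] := pext_unif g r10.
have [m m1m mr1] : exists2 m, (m1 <= m)%N & d%:R * (7 * a * (3 / 4) ^+ m) < r1.
  have : d%:R * (7 * a * (3 / 4) ^+ m) @[m --> \oo] --> (0 : R).
    rewrite -[X in _ --> X](mulr0 d%:R); apply: cvgMr.
    rewrite -[X in _ --> X](mulr0 (7 * a)); apply: cvgMr.
    by apply: cvg_expr; rewrite ger0_norm; lra.
  move/cvgrPdist_lt => /(_ r1 r10)[m2 _ hm2]; exists (maxn m1 m2); first exact: leq_maxl.
  have := hm2 (maxn m1 m2) (leq_maxr _ _); rewrite sub0r normrN.
  exact: le_lt_trans (ler_norm _).
pose rho0 := r1 / (d%:R * 2 ^+ m + 1).
have dm0 : 0 <= d%:R * 2 ^+ m :> R by rewrite mulr_ge0// exprn_ge0.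
have rho00 : 0 < rho0 by rewrite divr_gt0//; lra.
have eta20 : 0 < eta / 2 by rewrite divr_gt0.
have [rho [c [rho_gt0 rho_le c0 box]]] := incr_box_lower W_bm m g eta20 rho00.
have close k w : holder_set a (sW (eps k) w) -> incr_box W m (eps k) rho g w ->
    sup_dist (sW (eps k) w) g <= 3 * r1.
  move=> ah bw; set u := sW (eps k) w in ah *.
  apply: (sup_dist_grid (m := m) (rho := rho0)) => [||j i j2|s t s01 t01 st].
  - have [-> _] := ah; rewrite affine_pathE val_I0 -hz/= scale1r subr0 scale1r scale0r addr0.
    by rewrite subrr.
  - by rewrite mulrA /rho0 mulrCA ler_piMr ?(ltW r10)// ler_pdivrMr ?mul1r; lra.
  - apply: le_trans rho_le; rewrite mxE [X in _ + X]mxE /u incr_sW.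
    exact: (bw (Ordinal j2, i) I).
  - split; last exact: hm1 m1m _ _ s01 st.
    by apply: le_trans (ltW mr1); apply: holder_modulus => //; lra.
(* The box has an exponent of at most [J + eta / 2]. The target [J + eta] leaves room for the factor
   [(1 + 4 d) / c], in which [4 d] pays for the exceptional event and [1] remains. *)
have Jlt : J + eta / 2 < J + eta by lra.
have absorb := near_expR_absorb ((1 + 4 * d%:R) / c) eps_gt0 eps_cvg0 Jlt.
apply: filterS3 eps_le1 (ends_err zc r10) absorb => k e1 zk abk.
have [N [mN PN Nh]] := scaled_holder_prob (eps_gt0 k) e1 a8.
rewrite bridge_lawE; set Ev := [set w | _].
have mEv : measurable Ev by exact: measurable_noisy_bridge.
have mbox : measurable (incr_box W m (eps k) rho g) by exact: (measurable_incr_box W_bm).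
have sub : incr_box W m (eps k) rho g `<=` Ev `|` N.
  move=> w bw; have [Nw|nN] := pselect (N w); [by right|left].
  rewrite /Ev/= noisy_bridge_scale; apply: hr; rewrite ball_pathE -gh sup_distC.
  apply: le_lt_trans (bridge_map_lip _ _ _ _) _.
  by have := close k w (Nh _ nN) bw; rewrite /r1 in r10 zk *; lra.
have le1 : (P (incr_box W m (eps k) rho g) <= P Ev + P N)%E.
  apply: le_trans (measureU2 _ mEv mN); apply: le_measure; rewrite ?inE//.
  exact: measurableU.
have le2 := le_trans (box _ (eps_gt0 k) e1) le1.
have PEv : P Ev \is a fin_num by exact: fin_num_measure.
have PNf : P N \is a fin_num by exact: fin_num_measure.
rewrite -(fineK PEv) lee_fin.
move: le2 PN; rewrite -(fineK PEv) -(fineK PNf) -EFinD !lee_fin => le2 PN.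
have ek := eps_gt0 k.
have i1 : expR (- ((J + eta / 2) / eps k)) <=
    expR (- ((denergy m (pext g) / 2 + eta / 2) / eps k)).
  by rewrite ler_expR lerN2 ler_pM2r ?invr_gt0// lerD2r.
have i2 : expR (- (3 / 8 * a ^+ 2 / eps k)) <= expR (- ((J + eta) / eps k)).
  by rewrite ler_expR lerN2 ler_pM2r ?invr_gt0.
have i3 : (1 + 4 * d%:R) * expR (- ((J + eta) / eps k)) <= c * expR (- ((J + eta / 2) / eps k)).
  by rewrite [c * _]mulrC -ler_pdivrMr// mulrAC.
have i4 : 4 * d%:R * expR (- (3 / 8 * a ^+ 2 / eps k)) <= 4 * d%:R * expR (- ((J + eta) / eps k)).
  by rewrite ler_wpM2l// mulr_ge0.
have i5 : c * expR (- ((J + eta / 2) / eps k)) <=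
    c * expR (- ((denergy m (pext g) / 2 + eta / 2) / eps k)) by rewrite ler_pM2l.
lra.
Qed.

Lemma bridge_law_upper (A : set (pathE R d))
    (z_ : nat -> 'rV[R]_d * 'rV[R]_d) z (alpha : R) :
  closed A -> z_ k @[k --> \oo] --> z ->
  (alpha%:E < ereal_inf [set rate z h | h in A])%E ->
  exists2 C : R, 0 <= C &
    \forall k \near \oo, (bridge_law P W (eps k) (z_ k) A <= (C * expR (- (alpha / eps k)))%:E)%E.
Proof.
move=> cA zc alphaA.
pose a := 8 * (1 + `|alpha|).
have a8 : 8 <= a by rewrite /a; have := normr_ge0 alpha; lra.
have a0 : 0 <= a by lra.
have aalpha : alpha <= 3 / 8 * a ^+ 2.
  have := ler_norm alpha; have := normr_ge0 alpha; rewrite /a.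
  by move: `|_| => v; nra.
pose small (M : set Omega) C k := measurable M /\ (P M <= (C * expR (- (alpha / eps k)))%:E)%E.
(* The event that the scaled path lies in [U] need not be measurable, hence the
   measurable majorant [M]. *)
pose good (U : set (pathE R d)) := exists2 C : R, 0 <= C & \forall k \near \oo,
  exists2 M, small M C k &
    [set w | U (sW (eps k) w) /\ A (noisy_bridge (eps k) (z_ k) (W w))] `<=` M.
have goodS U V : V `<=` U -> good U -> good V.
  move=> VU [C C0 h]; exists C => //; apply: filterS h => k [M sM UM]; exists M => //.
  by move=> w [/VU Uw Aw]; apply: UM.
have goodU U V : good U -> good V -> good (U `|` V).
  move=> [C C0 h] [C' C'0 h']; exists (C + C'); first exact: addr_ge0.
  apply: filterS2 h h' => k [M [mM PM] UM] [M' [mM' PM'] UM']; exists (M `|` M').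
    split; first exact: measurableU.
    by rewrite mulrDl EFinD (le_trans (measureU2 P mM mM'))// leeD.
  by move=> w [[Uw|Vw] Aw]; [left; apply: UM|right; apply: UM'].
have good0 : good set0.
  exists 0 => //; apply: nearW => k; exists set0; last by move=> w [].
  by split; [exact: measurable0|rewrite measure0 mul0r].
(* If the image of [p] is outside of [A], so are the images of a whole ball for all large [k].
   Otherwise the rate of the image exceeds [alpha], and a box of a suitable level around [p] has
   small probability. *)
have local p : p I0 = 0 -> exists2 r : R, 0 < r & good (ball p r).
  move=> p0; have [Ap|nAp] := pselect (A (bridge_map z p)); last first.
    have /nbhs_ballP[r0 /= r00 hr] : nbhs (bridge_map z p) (~` A).
      by apply: open_nbhs_nbhs; split => //; exact: closed_openC.
    have r40 : 0 < r0 / 4 by rewrite divr_gt0.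
    exists (r0 / 4) => //; exists 0 => //; apply: filterS (ends_err zc r40) => k zk.
    exists set0; first by split; [exact: measurable0|rewrite measure0 mul0r].
    move=> w [/=]; rewrite ball_pathE sup_distC => pw; rewrite noisy_bridge_scale => Aw.
    have : (~` A) (bridge_map (z_ k) (sW (eps k) w)).
      apply: hr; rewrite ball_pathE sup_distC.
      by apply: le_lt_trans (bridge_map_lip _ _ _ _) _; move: pw; lra.
    exact.
  have ar : (alpha%:E < rate z (bridge_map z p))%E.
    by apply: lt_le_trans alphaA _; apply: ereal_inf_lbound; exists (bridge_map z p).
  have ends : (bridge_map z p I0, bridge_map z p I1) = z.
    by rewrite bridge_map0// bridge_map1; case: (z).
  (* Otherwise every dyadic energy of [p] is at most [2 alpha], those of its image are at most [c],
     and the rate of the image is at most [alpha]. *)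
  have [m mp] : exists m, alpha < denergy m (pext p) / 2.
    apply: contrapT => /forallNP nm.
    pose c := 2 * alpha + enorm (z.1 - z.2) ^+ 2.
    have [hH Ec] : in_H (bridge_map z p) /\ (energy (bridge_map z p) <= c%:E)%E.
      apply: denergy_in_H => m; have := bridge_map_denergy m z p0.
      by have /negP := nm m; rewrite -leNgt /c; lra.
    move: ar; rewrite (rate_in_H hH ends) lte_fin.
    have : fine (energy (bridge_map z p)) <= c.
      have [_ ?] := hH; rewrite -lee_fin fineK// ge0_fin_numE ?energy_ge0//.
    by rewrite /c; lra.
  have [rho [C [rho0 C0 box]]] := incr_box_upper W_bm mp.
  (* An increment is a difference of two values, each within [rho / 2] of that of [p]. *)
  exists (rho / 2); first by rewrite divr_gt0.
  exists C => //; apply: nearW => k; exists (incr_box W m (eps k) rho p).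
    by split; [exact: (measurable_incr_box W_bm)|exact: box].
  move=> w [/= pw _] [j i] _; rewrite /band/= -incr_sW.
  move: pw; rewrite ball_pathE => pw; set u := sW _ _ in pw *.
  have E : incr (pext u) m j 0 i - incr (pext p) m j 0 i =
      ((u (ipt (dyad m j.+1)) - p (ipt (dyad m j.+1))) -
       (u (ipt (dyad m j)) - p (ipt (dyad m j)))) 0 i.
    by rewrite /incr /pext; clearbody u; rewrite !mxE; ring.
  rewrite E; apply: le_trans (enorm_coord _ _) _; apply: le_trans (enormD _ _) _.
  have h1 := sup_dist_ub u p (ipt (dyad m j.+1)); have h2 := sup_dist_ub u p (ipt (dyad m j)).
  by rewrite enormN; move: pw; rewrite sup_distC; lra.
have [C C0 goodK] : good (holder_set a).
  apply: contrapT => nK.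
  (* The sets [V] such that [holder_set a `\` V] is good would form a proper
     filter, but each of its cluster points has a good ball around it. *)
  pose F : set_system (pathE R d) := [set V | good (holder_set a `\` V)].
  have FF : ProperFilter F.
    apply: Build_ProperFilter; last split.
    - by rewrite /F/= setD0.
    - by rewrite /F/= setDT.
    - by move=> U V FU FV; rewrite /F/= setDIr; exact: goodU.
    - by move=> U V UV; apply: goodS => h [hK nV]; split=> // /UV.
  have FK : F (holder_set a) by rewrite /F/= setDv.
  have [p [[p0 _] pF]] := compact_holder_set a0 FF FK.
  have [r r0 gr] := local p p0.
  have : F (~` ball p r) by apply: goodS gr => h [_] /contrapT.
  by move=> /pF/(_ (nbhsx_ballx p r r0))[h []].
exists (C + 4 * d%:R); first by rewrite addr_ge0// mulr_ge0.
apply: filterS2 eps_le1 goodK => k e1 [M [mM PM] AM].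
have [N [mN PN Nh]] := scaled_holder_prob (eps_gt0 k) e1 a8.
rewrite bridge_lawE; set Ev := [set w | _].
have mEv : measurable Ev.
  rewrite -[Ev]setCK; apply: measurableC.
  by apply: (measurable_noisy_bridge _ _ (A := ~` A)); exact: closed_openC.
have sub : Ev `<=` M `|` N.
  move=> w Aw; have [Nw|nN] := pselect (N w); [by right|left].
  by apply: AM; split=> //; exact: Nh.
apply: (@le_trans _ _ (P M + P N)%E).
  apply: le_trans (measureU2 _ mM mN); apply: le_measure; rewrite ?inE//.
  exact: measurableU.
rewrite mulrDl EFinD; apply: leeD => //; apply: le_trans PN _.
by rewrite lee_fin ler_wpM2l ?mulr_ge0// ler_expR lerN2 ler_pM2r ?invr_gt0.
Qed.

End Schilder.

Theorem proposition4p1 (R : realType) (d : nat)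
    (disp : measure_display) (Omega : measurableType disp)
    (P : probability Omega R) (W : Omega -> pathE R d)
    (W_bm : standard_brownian_motion P W)
    (eps : nat -> R) (eps_gt0 : forall k, 0 < eps k)
    (eps_noninc : nonincreasing_seq eps) (eps_cvg0 : eps k @[k --> \oo] --> 0) :
  (forall A : set (pathE R d), open A ->
     forall (z_ : nat -> 'rV[R]_d * 'rV[R]_d) (z : 'rV[R]_d * 'rV[R]_d),
     z_ k @[k --> \oo] --> z ->
     (- ereal_inf [set rate z h | h in A] <=
      limn_einf (fun k => (eps k)%:E * lne (bridge_law P W (eps k) (z_ k) A)))%E)
  /\
  (forall A : set (pathE R d), closed A ->
     forall (z_ : nat -> 'rV[R]_d * 'rV[R]_d) (z : 'rV[R]_d * 'rV[R]_d),
     z_ k @[k --> \oo] --> z ->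
     (limn_esup (fun k => (eps k)%:E * lne (bridge_law P W (eps k) (z_ k) A)) <=
      - ereal_inf [set rate z h | h in A])%E).
Proof.
split=> A hA z_ z zc.
  rewrite leeNl; apply: le_ereal_inf_tmp => _ [h Ah <-].
  rewrite leeNl; have [->|] := eqVneq (rate z h) +oo%E; first by rewrite leNye.
  rewrite -ltey => /rate_lty[hH hz]; rewrite (rate_in_H hH hz).
  apply/lee_addgt0Pr => eta eta0; rewrite -leeBlDr// -EFinB -opprD.
  apply: limn_einf_ge; have := bridge_law_lower W_bm eps_gt0 eps_cvg0 hA zc Ah hH hz eta0.
  by apply: filterS => k; exact: eps_lne_ge.
set I := ereal_inf _.
(* Working with real [beta] below [I] also covers an infinite [I]; an [alpha] strictly between the
   two absorbs the constant [C]. *)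
have upper (beta : R) : (beta%:E < I)%E ->
    (limn_esup (fun k => (eps k)%:E * lne (bridge_law P W (eps k) (z_ k) A)) <= (- beta)%:E)%E.
  move=> betaI; have [alpha /andP[ba aI]] : exists alpha : R, (beta < alpha) && (alpha%:E < I)%E.
    move: betaI; case: (I) => [i|_|//]; last by exists (beta + 1); rewrite ltey andbT; lra.
    by rewrite lte_fin => bi; exists ((beta + i) / 2); rewrite lte_fin; lra.
  have [C C0 hC] := bridge_law_upper W_bm eps_gt0 eps_cvg0 hA zc aI.
  apply: limn_esup_le; apply: filterS2 hC (near_expR_absorb C eps_gt0 eps_cvg0 ba) => k hk ek.
  apply: eps_lne_le => //; first exact: (measure_ge0 P).
  by apply: le_trans hk _; rewrite lee_fin.
case: I upper => [i||] upper.
- apply/lee_addgt0Pr => eta eta0; rewrite -EFinN -EFinD -[- i + eta]opprK opprD opprK.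
  by apply: upper; rewrite lte_fin; lra.
- rewrite leeNr leye_eq; apply/eqP/eqyP => r _.
  by rewrite leeNr; apply: upper; rewrite ltey.
- by rewrite leey.
Qed.
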